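(* Let $f_1,\dots,f_r\in\mathbb{Z}[x]$ be primitive irreducible polynomials of degree at least $2$ whose discriminants $D_1,\dots,D_r$ are pairwise coprime, and let $D=D_1\cdots D_r$. For each $i$ let $\alpha_i$ be a root of $f_i$, and let $L=\mathbb{Q}(\alpha_1,\dots,\alpha_r)$ with ring of integers $\mathcal{O}$. Let $\eta$ be a positive integer with $\eta\alpha_i\in\mathcal{O}$ for all $i$, and $R=\mathcal{O}[1/\eta]$. Then for every integer $n\ge2$ with $\gcd(n,\eta D)=1$, the maps $$\mathfrak{a}\mapsto(\alpha_1(\mathfrak{a}),\dots,\alpha_r(\mathfrak{a}))\quad\text{and}\quad(v_1,\dots,v_r)\mapsto(\alpha_1-v_1,\dots,\alpha_r-v_r,n)R$$ are mutually inverse bijections between $S_\eta(n)$ and the set of $r$-tuples $(v_1,\dots,v_r)\in\{0,\dots,n-1\}^r$ with $f_i(v_i)\equiv0\pmod n$ for all $1\le i\le r$.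
   Context: For a number field $L$ with ring of integers $\mathcal{O}$, positive integer $\eta$, $R=\mathcal{O}[1/\eta]$ and $Z_\eta=\mathbb{Z}[1/\eta]$: a proper nonzero ideal $\mathfrak{a}$ of $R$ is of degree one if $R/\mathfrak{a}\cong Z_\eta/(\mathfrak{a}\cap Z_\eta)$; its norm is $\mathfrak{N}(\mathfrak{a})=|R/\mathfrak{a}|$; $S_\eta(n)$ is the set of degree one ideals of norm $n$. For $\beta\in R$ and $\mathfrak{a}\in S_\eta(n)$, $\beta(\mathfrak{a})$ is the unique integer in $[0,n)$ with $\beta-\beta(\mathfrak{a})\in\mathfrak{a}$. $(x_1,\dots,x_k)R$ is the ideal of $R$ generated by $x_1,\dots,x_k$. *)

(* Defs.v *)
From HB Require Import structures.
From mathcomp Require Import all_boot all_order all_algebra all_field.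
From Stdlib Require Import ClassicalEpsilon.
Set Implicit Arguments. Unset Strict Implicit. Unset Printing Implicit Defensive.
Import Order.TTheory GRing.Theory Num.Theory.
Local Open Scope ring_scope.

Definition irreducible_Zx (p : {poly int}) : Prop :=
  p != 0 /\ p \isn't a GRing.unit /\
  forall q s : {poly int}, p = q * s -> q \is a GRing.unit \/ s \is a GRing.unit.

Definition primitive_Zx (p : {poly int}) : Prop := `|zcontents p|%N = 1%N.

Definition discZ (p : {poly int}) : int :=
  let d := (size p).-1 in
  (-1) ^+ (d * d.-1)./2 * (resultant p p^`() %/ lead_coef p)%Z.

Definition subfield_of_algC (S : algC -> Prop) : Prop :=
  S 1 /\ (forall x y, S x -> S y -> S (x - y)) /\
  (forall x y, S x -> S y -> S (x * y)) /\ (forall x, S x -> S x^-1).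

Definition inL (r : nat) (alpha : 'I_r -> algC) (x : algC) : Prop :=
  forall S, subfield_of_algC S -> (forall i, S (alpha i)) -> S x.

Definition inO r (alpha : 'I_r -> algC) (x : algC) : Prop :=
  inL alpha x /\ x \in Aint.

Definition inR r (alpha : 'I_r -> algC) (eta : nat) (x : algC) : Prop :=
  exists k : nat, inO alpha ((eta%:R) ^+ k * x).

Definition inZeta (eta : nat) (x : algC) : Prop :=
  exists (z : int) (k : nat), x = z%:~R / (eta%:R) ^+ k.

Definition is_idealR r (alpha : 'I_r -> algC) eta (a : algC -> Prop) : Prop :=
  (forall x, a x -> inR alpha eta x) /\ a 0 /\
  (forall x y, a x -> a y -> a (x + y)) /\
  (forall c x, inR alpha eta c -> a x -> a (c * x)).

(* |R/a| = n : n pairwise incongruent representatives covering R *)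
Definition normR_eq r (alpha : 'I_r -> algC) eta (a : algC -> Prop) (n : nat) : Prop :=
  exists s : seq algC, size s = n /\ (forall i, (i < n)%N -> inR alpha eta s`_i) /\
    (forall i j, (i < n)%N -> (j < n)%N -> i <> j -> ~ a (s`_i - s`_j)) /\
    (forall b, inR alpha eta b -> exists2 i, (i < n)%N & a (b - s`_i)).

(* degree one: the natural map Z_eta -> R/a is onto *)
Definition degree_one r (alpha : 'I_r -> algC) eta (a : algC -> Prop) : Prop :=
  forall b, inR alpha eta b -> exists z, inZeta eta z /\ a (b - z).

Definition in_S r (alpha : 'I_r -> algC) eta (n : nat) (a : algC -> Prop) : Prop :=
  [/\ is_idealR alpha eta a,
      (exists x, inR alpha eta x /\ ~ a x),
      (exists x, a x /\ x <> 0),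
      degree_one alpha eta a & normR_eq alpha eta a n].

(* beta(a) : the integer k in [0,n) with beta - k in a (chosen by epsilon;
   unique whenever a is in S_eta(n)) *)
Definition resid (a : algC -> Prop) (n : nat) (b : algC) : nat :=
  epsilon (inhabits 0%N) (fun k : nat => (k < n)%N /\ a (b - k%:R)).

Definition gen_ideal r (alpha : 'I_r -> algC) eta (xs : seq algC) (y : algC) : Prop :=
  exists cs : seq algC, size cs = size xs /\
    (forall i, (i < size xs)%N -> inR alpha eta cs`_i) /\
    y = \sum_(i < size xs) cs`_i * xs`_i.

Definition psi_map r (alpha : 'I_r -> algC) eta (n : nat) (v : 'I_r -> nat) : algC -> Prop :=
  gen_ideal alpha eta ([seq alpha i - (v i)%:R | i <- enum 'I_r] ++ [:: n%:R]).

Definition phi_map r (alpha : 'I_r -> algC) (n : nat) (a : algC -> Prop) : 'I_r -> nat :=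
  fun i => resid a n (alpha i).

Definition root_tuple r (f : 'I_r -> {poly int}) (n : nat) (v : 'I_r -> nat) : Prop :=
  forall i, (v i < n)%N /\ (n%:Z %| (f i).[(v i)%:Z])%Z.

(* Main.v *)
(* Degree one ideals of norm n are the kernels of ring maps R -> Z/n, so one has
   to show that R is generated by the alpha i after inverting integers prime to n,
   and that each tuple of roots of the f i modulo n is realised by such a map.

   The first point comes from Euler's identity
   sum_k x^k g(q_k) = f'(x) [g x = x], where f(X) / (X - x) = sum_k q_k X^k, g runs
   over the Galois group and the q_k are algebraic integers: it expands
   prod_i f_i'(alpha i) y, for y in O, in the alpha i with integral traces as
   coefficients.

   For the second, prod_i (f_i(X) / (X - alpha i))(v i) multiplies the ideal
   (alpha i - v i, n) into n times the algebraic integers, up to powers of eta. If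
   this ideal contained too many integers, some prime p | n would divide that
   product and all its conjugates. Once every tuple of roots of the f i is
   conjugate to alpha, the sum of these conjugates is prod_i f_i'(v i), which is
   prime to p.

   That all tuples of roots are conjugate rests on Minkowski's theorem: the
   intersection of two fields of coprime discriminants is everywhere unramified,
   hence equal to Q. Here "unramified" is the existence of algebraic integers a_k,
   b_k with sum_k a_k g(b_k) = [g = 1]; this yields dual integral bases, so a
   matrix of conjugates of determinant at most 1, and the box principle, applied to
   suitably rescaled conjugates, contradicts that a nonzero algebraic integer has
   norm at least 1. *)
Require Import Defs.
From HB Require Import structures.
From mathcomp Require Import all_boot all_order all_algebra all_fingroup all_field.
From mathcomp Require Import zify ring lra polyorder.
From Stdlib Require Import ClassicalEpsilon.
Set Implicit Arguments. Unset Strict Implicit. Unset Printing Implicit Defensive.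
Import Order.TTheory GRing.Theory Num.Theory.
Local Open Scope ring_scope.

(** * Minkowski's theorem on linear forms *)

(** The main obstacle is that the f i need not be monic: the alpha i are then not integral, and
    their powers do not span orders. The coefficients of f(X) / (X - x) replace them, being integral
    for every f in Z[X]. Euler's identity still produces the constant f'(x), whose product over the
    roots differs from the discriminant by a power of the leading coefficient, up to sign. Since
    only the discriminants are assumed coprime, independence of the roots requires a finer system
    whose squared determinant is exactly the discriminant up to sign. The leading coefficient comes
    back in the resultants of f and f', where it is harmless because it divides a power of eta.

    Ramification is never measured by primes, differents or field discriminants. What is tracked are
    multiples of indicator functions of subgroups of a Galois group, written as sums a g(b): these
    multiply for composita, combine linearly and descend to subfields by traces.

    Dual bases give a determinant at most 1, not less than 1. The bound on linear forms is therefore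
    needed with non strict inequalities, and its equality case has to be excluded separately. *)

(** If det A is nonzero, the lattice A Z^N has index |det A|, less than the number of points of the
    box {0, ..., m - 1}^N, so two points of the box are congruent modulo it and their difference is
    the required A x. The Smith form makes the classes explicit; if one of its entries vanishes, A
    kills a nonzero vector. *)
Lemma int_box_pigeonhole (N : nat) (A : 'M[int]_N) (m : nat) :
    (`|\det A| < m ^ N)%N ->
  exists2 x : 'cV[int]_N, x != 0 & forall i, (`|(A *m x)%R i ord0| < m)%N.
Proof.
case: (int_Smith_normal_form A) => L uL [R uR [d _ defA]] ltA.
pose dd (i : 'I_N) : int := d`_i.
set D := \matrix_(i, j) _ in defA.
have ALR : A *m invmx R = L *m D by rewrite defA mulmxK.
have Dz (z : 'cV_N) i : (D *m z) i 0 = dd i * z i 0.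
  rewrite mxE (bigD1 i) //= mxE eqxx mulr1n big1 ?addr0 // => j /negPf ne.
  by rewrite mxE eq_sym (inj_eq val_inj) ne mulr0n mul0r.
have [/existsP[i /eqP di0] | d_neq0] := boolP [exists i : 'I_N, dd i == 0].
  exists (invmx R *m delta_mx i 0).
    apply/eqP => /(congr1 (mulmx R)); rewrite mulmx0 mulKVmx // => /matrixP/(_ i 0).
    by rewrite !mxE !eqxx.
  move=> j; rewrite mulmxA ALR -mulmxA.
  have -> : D *m delta_mx i 0 = 0 :> 'cV_N.
    apply/matrixP => k l; rewrite ord1 Dz !mxE eqxx andbT.
    by case: eqP => [->|_]; rewrite ?mulr0 // di0 mul0r.
  rewrite mulmx0 mxE absz0; case: m ltA => // ; rewrite exp0n //.
  exact: leq_ltn_trans (ltn_ord i).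
have dn0 (i : 'I_N) : dd i != 0 by move/existsPn: d_neq0; apply.
have detA : `|\det A|%N = (\prod_(i < N) `|dd i|)%N.
  rewrite defA !det_mulmx !abszM.
  have u1 (M : 'M[int]_N) : M \in unitmx -> `|\det M|%N = 1%N.
    by rewrite unitmxE => /orP[]/eqP->.
  rewrite (u1 L) // (u1 R) // mul1n muln1.
  have -> : D = diag_mx (\row_i dd i).
    by apply/matrixP => i j; rewrite !mxE (inj_eq val_inj).
  rewrite det_diag (big_morph absz abszM (erefl : absz 1 = 1%N)).
  by apply: eq_bigr => i _; rewrite mxE.
pose vec (y : {ffun 'I_N -> 'I_m}) : 'cV[int]_N := \col_i (y i)%:Z.
(* A common bound lets the residues modulo the various [dd i] be stored in a single finite type. *)
pose B := (\max_(i < N) `|dd i|)%N.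
pose phi y : {ffun 'I_N -> 'I_B.+1} :=
  [ffun i => inord `|(((invmx L *m vec y)%R i ord0) %% dd i)%Z|].
have ltd (i : 'I_N) (a : int) : (`|(a %% dd i)%Z| < `|dd i|)%N.
  by rewrite -ltz_nat gez0_abs ?modz_ge0 // ltz_mod.
have leB (i : 'I_N) : (`|dd i| <= B)%N by exact: (leq_bigmax i).
have phiE y i : val (phi y i) = `|(((invmx L *m vec y)%R i ord0) %% dd i)%Z|%N.
  by rewrite ffunE [LHS]inordK // ltnS (leq_trans (ltnW (ltd i _))) ?leB.
have /injectivePn[y1 [y2 ne12 eq12]] : ~~ injectiveb phi.
  apply/injectiveP => /card_codom eqc; move: ltA; rewrite ltnNge => /negP[].
  have -> : (m ^ N = #|codom phi|)%N by rewrite eqc card_ffun !card_ord.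
  pose F (i : 'I_N) := [pred k : 'I_B.+1 | (k < `|dd i|)%N].
  have : codom phi \subset (family F : simpl_pred {ffun _ -> _}).
    apply/subsetP => _ /codomP[y ->]; apply/familyP => i.
    by rewrite inE phiE ltd.
  move/subset_leq_card/leq_trans; apply; rewrite card_family detA.
  rewrite foldrE big_map big_enum /=; apply: leq_prod => i _.
  rewrite -[X in (_ <= X)%N](card_ord `|dd i|).
  have lt (k : 'I_B.+1) : k \in F i -> (k < `|dd i|)%N by [].
  have [d0|dpos] := posnP `|dd i|%N.
    by rewrite eq_card0 // => k; rewrite inE d0.
  pose g (k : 'I_B.+1) : 'I_`|dd i| := insubd (Ordinal dpos) (val k).
  have gi : {in F i &, injective g}.
    move=> a b aF bF /(congr1 val); rewrite !val_insubd !lt // => e; exact: val_inj.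
  by rewrite -(card_in_image gi) max_card.
pose z : 'cV[int]_N := \col_i ((invmx L *m (vec y1 - vec y2))%R i ord0 %/ dd i)%Z.
have eqz : L *m D *m z = vec y1 - vec y2.
  rewrite -mulmxA; suff -> : D *m z = invmx L *m (vec y1 - vec y2) by rewrite mulKVmx.
  apply/matrixP => i j; rewrite ord1 Dz [z i 0]mxE mulrC divzK //.
  rewrite mulmxBr [X in (_ %| X)%Z]mxE [X in (_ %| _ + X)%Z]mxE -eqz_mod_dvd; apply/eqP.
  have := congr1 (fun u : {ffun _ -> _} => Posz (val (u i))) eq12.
  by rewrite /= !phiE !gez0_abs ?modz_ge0.
have Ax : A *m (invmx R *m z) = vec y1 - vec y2 by rewrite mulmxA ALR.
exists (invmx R *m z).
  apply: contra ne12 => /eqP x0; move: Ax; rewrite x0 mulmx0 => /esym/eqP.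
  rewrite subr_eq0 => /eqP/matrixP e; apply/eqP/ffunP => i.
  by move: (e i 0); rewrite !mxE => -[] /val_inj.
move=> i; rewrite Ax !mxE; case: (y1 i) (y2 i) => [a lta] [b ltb] /=; lia.
Qed.

(** The extreme case is x i = a, y i = a + 1; the induction uses x X - y Y = x (X - Y) + (x - y)
    Y. *)
Lemma prod_perturb (R : numDomainType) (I : Type) (s : seq I) (x y : I -> R) (a : R) :
    0 <= a -> (forall i, `|x i| <= a) -> (forall i, `|x i - y i| <= 1) ->
  `|\prod_(i <- s) x i - \prod_(i <- s) y i| <= (a + 1) ^+ size s - a ^+ size s.
Proof.
move=> a0 xa xy1.
have ya i : `|y i| <= a + 1.
  rewrite -[y i](subKr (x i)) (le_trans (ler_normB _ _)) // lerD //.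
have a10 : 0 <= a + 1 by rewrite addr_ge0.
elim: s => [|i s IHs]; first by rewrite !big_nil !subrr normr0.
rewrite !big_cons /= !exprS.
set X := \prod_(j <- s) x j in IHs *; set Y := \prod_(j <- s) y j in IHs *.
have -> : x i * X - y i * Y = x i * (X - Y) + (x i - y i) * Y by ring.
have -> : (a + 1) * (a + 1) ^+ size s - a * a ^+ size s
  = a * ((a + 1) ^+ size s - a ^+ size s) + 1 * (a + 1) ^+ size s by ring.
rewrite (le_trans (ler_normD _ _)) // !normrM lerD // ler_pM //.
rewrite /Y; elim: (s) => [|j t IHt]; first by rewrite big_nil normr1 expr0.
by rewrite big_cons normrM exprS ler_pM.
Qed.

Lemma subX1_le (R : numDomainType) (a : R) (n : nat) :
  0 <= a -> (a + 1) ^+ n - a ^+ n <= n%:R * (a + 1) ^+ n.-1.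
Proof.
move=> a0; rewrite subrXX addrAC subrr add0r mul1r.
rewrite -[n in n%:R]card_ord -sum1_card natr_sum mulr_suml ler_sum // => i _.
have e : n.-1 = (n.-1 - i + i)%N by have := ltn_ord i; lia.
rewrite mul1r [in leRHS]e exprD ler_wpM2l ?exprn_ge0 ?addr_ge0 //.
by rewrite lerXn2r ?nnegrE ?addr_ge0 // lerDl.
Qed.

(** The point is the exponent n - 1: rounding the entries of T U changes a determinant of order T^n
    only by O(T^(n-1)). *)
Lemma det_perturb (R : numDomainType) (n : nat) (X Y : 'M[R]_n) (a : R) :
    0 <= a -> (forall i j, `|X i j| <= a) -> (forall i j, `|X i j - Y i j| <= 1) ->
  `|\det X - \det Y| <= (n`! * n)%:R * (a + 1) ^+ n.-1.
Proof.
move=> a0 Xa XY; rewrite /determinant -sumrB (le_trans (ler_norm_sum _ _ _)) //.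
rewrite natrM -mulrA -card_Sn -sum1_card natr_sum mulr_suml ler_sum // => s _.
rewrite -mulrBr normrM normrX normrN1 expr1n !mul1r.
apply: le_trans (subX1_le _ a0).
rewrite -[n in _ <= (_ + _) ^+ n - _ ^+ n]size_enum_ord.
by rewrite -!big_enum; apply: prod_perturb.
Qed.

Lemma mx_nat_bound (m n : nat) (A : 'M[algC]_(m, n)) :
  exists b : nat, forall i j, `|A i j| <= b%:R.
Proof.
exists (\max_i \max_j Num.bound `|A i j|) => i j.
apply: le_trans (ltW (archi_boundP (normr_ge0 _))) _.
rewrite ler_nat (leq_trans _ (leq_bigmax i)) //.
by rewrite (leq_trans _ (leq_bigmax j)).
Qed.

Lemma mulmx_norm_le (R : numDomainType) (m n : nat) (A : 'M[R]_(m, n)) (x : 'cV[R]_n)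
    (a b : R) (i : 'I_m) :
    (forall j, `|A i j| <= a) -> (forall j, `|x j 0| <= b) ->
  `|(A *m x) i 0| <= n%:R * (a * b).
Proof.
move=> Aa xb; rewrite mxE (le_trans (ler_norm_sum _ _ _)) //.
rewrite -[n in n%:R]card_ord -sum1_card natr_sum mulr_suml ler_sum // => j _.
by rewrite mul1r normrM ler_pM.
Qed.

Lemma unit_gap (t : algC) : 1 < t -> exists q : nat, 1 + q.+1%:R^-1 < t.
Proof.
move=> t1; exists (Num.bound (t - 1)^-1).
rewrite -ltrBrDl invf_plt ?qualifE /= ?ltr0Sn ?subr_gt0 //.
apply: lt_trans (_ : (Num.bound (t - 1)^-1)%:R < _); last by rewrite ltr_nat.
by rewrite archi_boundP // invr_ge0 subr_ge0 ltW.
Qed.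

(** A box contains finitely many integer vectors, so the strict inequalities hold with a common
    margin. *)
Lemma bounded_cV_gap (n Y : nat) (U : 'M[algC]_n) :
    (forall x : 'cV[int]_n, x != 0 ->
       exists i, 1 < `|(U *m map_mx intr x) i 0|) ->
  exists q : nat, forall x : 'cV[int]_n, x != 0 -> (forall j, `|x j ord0| <= Y)%N ->
    exists i, 1 + q.+1%:R^-1 < `|(U *m map_mx intr x) i 0|.
Proof.
move=> gtU.
pose vec (y : {ffun 'I_n -> 'I_(Y + Y).+1}) : 'cV[int]_n := \col_i ((y i)%:Z - Y%:Z).
have Q y : exists q : nat, vec y != 0 ->
    exists i, 1 + q.+1%:R^-1 < `|(U *m map_mx intr (vec y)) i 0|.
  have [->|/gtU[i /unit_gap[q ltq]]] := eqVneq (vec y) 0; first by exists 0%N.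
  by exists q => _; exists i.
have [q qP] := fin_all_exists Q.
exists (\max_y q y) => x x0 xY.
pose y := [ffun i => (inord `|(x i ord0 + Y%:Z)%R|) : 'I_(Y + Y).+1].
have Ey : vec y = x.
  apply/matrixP => i j; rewrite (ord1 j : j = ord0) !mxE ffunE inordK; have := xY i; lia.
have [|i lti] := qP y; first by rewrite Ey.
exists i; rewrite -Ey; apply: le_lt_trans lti.
rewrite lerD2l lef_pV2 ?posrE ?ltr0Sn // ler_nat ltnS.
exact: leq_bigmax.
Qed.

Lemma floor_approx (x : algC) : x \is Num.real -> `|x - (Num.floor x)%:~R| <= 1.
Proof.
move=> xr; have [l u] := andP (real_floor_itv xr).
rewrite ger0_norm ?subr_ge0 // lerBlDl -[X in _ + X]/(1%:~R) -rmorphD ltW //.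
Qed.

Lemma leq_exp2rW (a b e : nat) : (a <= b)%N -> (a ^ e <= b ^ e)%N.
Proof. by case: e => // e ab; rewrite leq_exp2r. Qed.

(** The inequality obtained by applying the inverse of U is solved for X: the lower bounds on S and
    T let half of T X absorb the term in X on the right, which leaves a bound independent of T. *)
Lemma linear_bound (n b X S T : nat) :
    (T * X <= n * (b * (T + S + n * X)))%N -> (0 < T)%N ->
    (2 * S <= T)%N -> (n * (n * b) <= S)%N ->
  (X <= 4 * (n * b))%N.
Proof.
rewrite mulnA !mulnDr => TX T0 ST nbS; set B := (n * b)%N in TX nbS *.
have h1 : (B * (n * X) <= S * X)%N by rewrite mulnCA mulnA leq_mul2r nbS orbT.
have h2 : (2 * S * X <= T * X)%N by rewrite leq_mul2r ST orbT.
have h3 : (B * (2 * S) <= B * T)%N by rewrite leq_mul2l ST orbT.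
rewrite -(leq_pmul2l T0) mulnCA [(T * B)%N]mulnC.
lia.
Qed.

(** The pigeonhole needs an integer matrix and a strict bound. So T U is rounded to an integer
    matrix and the side of the box is enlarged from T to T + S, which absorbs the change of the
    determinant. The vector x obtained has |U x| at most 1 + O(1/T) and entries bounded
    independently of T; if no x satisfied the non strict bound, the uniform margin would exclude
    this for large T. *)
Lemma Minkowski_cube (n : nat) (U : 'M[algC]_n) :
    (0 < n)%N -> (forall i j, U i j \is Num.real) -> U \in unitmx -> `|\det U| <= 1 ->
  exists2 x : 'cV[int]_n, x != 0 & forall i, `|(U *m map_mx intr x) i 0| <= 1.
Proof.
move=> n0 Ur uU detU; apply: NNPP => noX.
have gtU (x : 'cV[int]_n) : x != 0 -> exists i, 1 < `|(U *m map_mx intr x) i 0|.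
  move=> x0; apply: NNPP => noi; apply: noX; exists x => // i.
  by rewrite real_leNgt ?normr_real ?real1 //; apply/negP => lt1; apply: noi; exists i.
have [a aP] := mx_nat_bound U.
have [b bP] := mx_nat_bound (invmx U).
(* This bound on the entries of x does not involve T, so the margin 1/(q + 1) can be fixed before
   T. *)
pose Y := (4 * (n * b))%N.
have [q qP] := bounded_cV_gap Y gtU.
(* The summands of S bound, in order, the rounding error of the determinant (divided by T^(n-1)),
   the rounding error of A x, and the quantity required by [linear_bound]. The choice of T makes
   T/(q + 1) equal to 2 S. *)
pose S := (n`! * n * a.+1 ^ n.-1 + n * Y + n * n * b).+1.
pose T := (2 * q.+1 * S)%N; pose m := (T + S)%N.
have T0 : 0 < T%:R :> algC by rewrite ltr0n /T /S; lia.
pose A : 'M[int]_n := \matrix_(i, j) Num.floor (T%:R * U i j).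
pose AC : 'M[algC]_n := map_mx intr A.
have approx i j : `|(T%:R *: U) i j - AC i j| <= 1.
  by rewrite !mxE floor_approx // rpredM ?realn.
have detA : (`|\det A| < m ^ n)%N.
  rewrite -(ltr_nat algC) natr_absz intr_norm -det_map_mx -/AC.
  rewrite -[\det AC](subKr (\det (T%:R *: U))).
  apply: le_lt_trans (ler_normB _ _) _.
  apply: le_lt_trans (_ : (T ^ n)%:R + (n`! * n * (a * T + 1) ^ n.-1)%:R < _).
    rewrite lerD //.
      by rewrite detZ normrM normrX normr_nat natrX ler_piMr ?exprn_ge0 ?ler0n.
    rewrite (natrM _ (n`! * n)) natrX natrD (natrM _ a); apply: det_perturb => //.
      by rewrite mulr_ge0 ?ler0n.
    by move=> i j; rewrite mxE normrM normr_nat mulrC ler_wpM2r ?ler0n.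
  rewrite -natrD ltr_nat.
  have T1 : (0 < T)%N by rewrite -(ltr0n algC).
  apply: leq_trans (_ : T ^ n + S * T ^ n.-1 <= _)%N.
    rewrite ltn_add2l; apply: leq_ltn_trans (_ : n`! * n * (a.+1 * T) ^ n.-1 < _)%N.
      by rewrite leq_mul2l leq_exp2rW ?orbT //; lia.
    by rewrite expnMn mulnA ltn_pmul2r ?expn_gt0 ?T1 // /S; lia.
  rewrite /m -(prednK n0) /= expnS -mulnDl expnS leq_mul //.
  by rewrite leq_exp2rW ?leq_addr.
have [x x0 xm] := int_box_pigeonhole detA.
pose xC : 'cV[algC]_n := map_mx intr x; pose X := (\max_j `|x j ord0|)%N.
have xX j : `|xC j 0| <= X%:R.
  by rewrite mxE -intr_norm -natr_absz ler_nat; apply: (leq_bigmax j).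
have TUx i : T%:R * `|(U *m xC) i 0| <= (m + n * X)%:R.
  rewrite -[T%:R]normr_nat -normrM.
  have -> : T%:R * (U *m xC) i 0 = (AC *m xC) i 0 + ((T%:R *: U - AC) *m xC) i 0.
    rewrite mulmxBl -scalemxAl; move: (U *m xC) (AC *m xC) => V V'.
    by rewrite !mxE addrCA subrr addr0.
  rewrite (le_trans (ler_normD _ _)) // natrD lerD //.
    by rewrite -map_mxM mxE -intr_norm -natr_absz ler_nat ltnW.
  rewrite natrM -[X%:R]mul1r; apply: mulmx_norm_le => // j.
  by have := approx i j; rewrite !mxE.
have XY : (X <= Y)%N.
  have TX : (T * X <= n * (b * (m + n * X)))%N.
    have TxX j : (T * `|x j ord0| <= n * (b * (m + n * X)))%N.
      rewrite -(ler_nat algC) natrM natr_absz intr_norm.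
      have -> : (x j ord0)%:~R = (invmx U *m (U *m xC)) j 0 by rewrite mulKmx // mxE.
      rewrite -[T%:R]normr_nat -normrM.
      have -> : T%:R * (invmx U *m (U *m xC)) j 0 = (invmx U *m (T%:R *: (U *m xC))) j 0.
        by rewrite -scalemxAr !mxE.
      rewrite 2!natrM; apply: mulmx_norm_le => // i.
      by rewrite mxE normrM normr_nat.
    have [|j Xj] := @bigop.eq_bigmax _ (fun j => `|x j ord0|%N); first by rewrite card_ord.
    by rewrite {1}/X Xj.
  have S2T : (2 * S <= T)%N by rewrite /T -mulnA leq_mul2l /= leq_pmull.
  have nbS : (n * (n * b) <= S)%N by rewrite /S mulnA; lia.
  by apply: linear_bound TX _ S2T nbS; rewrite -(ltr0n algC).
have [|i] := qP x x0; first by move=> j; apply: leq_trans XY; apply: (leq_bigmax j).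
rewrite -/xC -(ltr_pM2l T0) => ltT; have := lt_le_trans ltT (TUx i).
have -> : T%:R * (1 + q.+1%:R^-1) = (T + 2 * S)%:R :> algC.
  rewrite mulrDr mulr1 natrD; congr (_ + _).
  by rewrite /T mulnAC natrM mulfK // pnatr_eq0.
rewrite ltr_nat /m => ltm.
have : (n * X <= n * Y)%N by rewrite leq_mul2l XY orbT.
by rewrite /S in ltm; lia.
Qed.

Lemma Aint_frac (p q : nat) : (p%:R / q.+1%:R : algC) \in Aint -> (q.+1 %| p)%N.
Proof.
move=> /Cint_rat_Aint; rewrite rpred_div ?rpred_nat // => /(_ isT)/intrP[m e].
have {}e : p%:Z = m * q.+1%:Z.
  apply: (@intr_inj algC); rewrite rmorphM /= -[p%:~R]/(p%:R) -[(q.+1)%:~R]/(q.+1%:R).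
  by rewrite -e divfK // pnatr_eq0.
by apply/dvdnP; exists `|m|%N; rewrite -[p]/(`|p%:Z|%N) e abszM.
Qed.

(** Such weights respect complex conjugation and do not change the product of the embeddings. In the
    equality case of the box bound every (t i)^-1 would turn out to be integral, hence the last
    condition. *)
Lemma twist_exists (n : nat) (s : 'I_n -> 'I_n) :
    (1 < n)%N -> involutive s ->
  exists t : 'I_n -> algC, [/\ forall i, (t i)^* = t (s i), \prod_i t i = 1
    & exists i, (t i)^-1 \notin Aint].
Proof.
move=> n1 sK; have [/existsP[i0 si0]|/existsPn s_id] := boolP [exists i, s i != i].
  (* A point of the unit circle with z + conj(z) = 6/5, hence not an algebraic integer; it comes
     from 3^2 + 4^2 = 5^2. *)
  pose z : algC := (3 + 4 * 'i) / 5.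
  have zc : z^* = (3 - 4 * 'i) / 5.
    by rewrite /z rmorphM fmorphV rmorphD rmorphM /= conjCi !conjC_nat mulrN.
  have zz : z * z^* = 1.
    rewrite zc /z; have := sqrCi algC; move: 'i => I I2.
    have -> : (3 + 4 * I) / 5 * ((3 - 4 * I) / 5) = (9 - 16 * I ^+ 2) / 25 by field.
    by rewrite I2; field.
  have z0 : z != 0 by apply: contra_eq_neq zz => ->; rewrite mul0r eq_sym oner_eq0.
  exists (fun i => if i == i0 then z else if i == s i0 then z^* else 1); split=> [i||].
  - rewrite (inj_eq (inv_inj sK)) (can2_eq sK sK).
    have [->|ne] := eqVneq i i0; first by rewrite eq_sym (negPf si0).
    by case: eqP => _; rewrite ?conjCK ?rmorph1.
  - rewrite (bigD1 i0) //= eqxx (bigD1 (s i0)) //= (negPf si0) eqxx.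
    by rewrite big1 ?mulr1 // => i /andP[/negPf-> /negPf->].
  exists i0; rewrite eqxx; apply/negP => zA.
  have zA' : (z^-1)^* \in Aint by rewrite (Aint_aut Num.conj).
  suff e : z^-1 + (z^-1)^* = 6%:R / 5%:R.
    by have := rpredD zA zA'; rewrite e => /Aint_frac.
  have -> : z^-1 = z^* by apply: (mulfI z0); rewrite mulfV // zz.
  by rewrite conjCK zc /z; field.
(* All weights must now be real: 2 and 1/2 are placed at two distinct indices, which exist because n
   > 1. *)
pose i0 : 'I_n := Ordinal (ltnW n1); pose i1 : 'I_n := Ordinal n1.
have {}s_id i : s i = i by apply/eqP; have := s_id i; rewrite negbK.
exists (fun i => if i == i0 then 2 else if i == i1 then 2^-1 else 1); split=> [i||].
- rewrite s_id; case: (i == i0); first by rewrite conjC_nat.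
  by case: (i == i1); rewrite ?rmorph1 // fmorphV /= conjC_nat.
- rewrite (bigD1 i0) //= (bigD1 i1) //= big1; first by rewrite mulr1 mulfV // pnatr_eq0.
  by move=> i /andP[/negPf-> /negPf->].
by exists i0; rewrite eqxx -div1r; apply/negP => /(@Aint_frac 1 1).
Qed.

Lemma prod_le1_eq1 (R : numDomainType) (I : finType) (F : I -> R) (i0 : I) :
  (forall i, 0 <= F i <= 1) -> 1 <= \prod_i F i -> F i0 = 1.
Proof.
move=> F01 ge1; apply/eqP; rewrite eq_le; case/andP: (F01 i0) => F0 -> /=.
apply: le_trans ge1 _; rewrite (bigD1 i0) //= ler_piMr //.
by apply: prodr_ile1 => i _.
Qed.

(* For complex embeddings the real forms Re z + Im z and Re z - Im z, of squared
   sum 2 |z|^2, replace z and z^*: this change of variables is unitary. Rescaling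
   the embeddings by t rules out the equality case of the box bound. *)
Lemma norm_form_dim_le1 (n : nat) (W : 'M[algC]_n) (s : 'I_n -> 'I_n) :
    (forall i j, W i j \in Aint) -> W \in unitmx -> `|\det W| <= 1 ->
    (forall i j, (W i j)^* = W (s i) j) ->
    (forall x : 'cV[int]_n, x != 0 -> 1 <= `|\prod_i (W *m map_mx intr x) i 0|) ->
  (n <= 1)%N.
Proof.
move=> WA uW detW Wc normW; rewrite leqNgt; apply/negP => n1.
have sK : involutive s.
  (* Conjugating twice shows that rows i and s (s i) of W agree; were these indices distinct, det W
     would vanish. *)
  move=> i; apply/eqP/contraT => ne; move: uW.
  rewrite unitmxE (determinant_alternate ne) ?unitr0 // => j.
  by rewrite -!Wc conjCK.
have [t [tc tprod [i0 ti0]]] := twist_exists n1 sK.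
(* For this a, a z + conj(a) conj(z) = Re z + Im z and a conj(z) + conj(a) z = Re z - Im z. *)
pose a : algC := (1 - 'i) / 2.
have ac : a^* = (1 + 'i) / 2.
  by rewrite /a rmorphM fmorphV rmorphB /= conjCi conjC_nat rmorph1 opprK.
have aa : a * a^* = 2^-1.
  rewrite ac /a; have := sqrCi algC; move: 'i => I I2.
  have -> : (1 - I) / 2 * ((1 + I) / 2) = (1 - I ^+ 2) / 4 by field.
  by rewrite I2; field.
have a2 : a ^+ 2 + a^* ^+ 2 = 0.
  rewrite ac /a; have := sqrCi algC; move: 'i => I I2.
  have -> : ((1 - I) / 2) ^+ 2 + ((1 + I) / 2) ^+ 2 = (1 + I ^+ 2) / 2 by field.
  by rewrite I2; field.
clear ac; clearbody a.
pose P : 'M[algC]_n := \matrix_(i, k) (k == s i)%:R.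
have PM m (V : 'M_(n, m)) i j : (P *m V) i j = V (s i) j.
  rewrite mxE (bigD1 (s i)) //= mxE eqxx mul1r big1 ?addr0 // => k /negPf ne.
  by rewrite mxE ne mul0r.
have PP : P *m P = 1%:M.
  by apply/matrixP => i j; rewrite PM !mxE sK eq_sym.
pose M := a%:M + a^* *: P.
have detM : `|\det M| = 1.
  have Mc : map_mx Num.conj M = a^*%:M + a *: P.
    apply/matrixP => i j; rewrite !mxE rmorphD rmorphM /= conjCK conjC_nat.
    by case: eqP => _; rewrite ?mulr1n ?mulr0n ?rmorph0.
  have : \det (M *m map_mx Num.conj M) = 1.
    rewrite Mc /M mulmxDl !mulmxDr !mul_scalar_mx mul_mx_scalar -scalemxAl.
    rewrite -scalemxAr PP -[RHS](det1 algC n); congr (\det _).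
    apply/matrixP => i j; rewrite !mxE.
    set p := (_ == s _)%:R; set e := (i == j); rewrite -[_ *+ e]mulr_natr -[1 *+ e]mulr_natr.
    transitivity (a * a^* * 2 * e%:R + (a ^+ 2 + a^* ^+ 2) * p); first by ring.
    by rewrite aa a2; case: e; field.
  rewrite det_mulmx det_map_mx /= => /eqP; rewrite -normCK sqrp_eq1 ?normr_ge0 //.
  by move/eqP.
pose Z : 'M_n := diag_mx (\row_i t i) *m W.
have ZE m (x : 'M_(n, m)) i j : (Z *m x) i j = t i * (W *m x) i j.
  by rewrite -mulmxA mul_diag_mx !mxE.
pose U := M *m Z.
have UE m (x : 'M_(n, m)) i j :
    (U *m x) i j = a * (Z *m x) i j + a^* * (Z *m x) (s i) j.
  rewrite -mulmxA /M mulmxDl mul_scalar_mx -scalemxAl.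
  by rewrite [LHS]mxE [X in X + _]mxE [X in _ + X]mxE PM.
have Wxc (x : 'cV[int]_n) i : ((W *m map_mx intr x) i 0)^* = (W *m map_mx intr x) (s i) 0.
  rewrite !mxE rmorph_sum; apply: eq_bigr => k _.
  by rewrite rmorphM /= Wc mxE rmorph_int.
have Zxc (x : 'cV[int]_n) i : ((Z *m map_mx intr x) i 0)^* = (Z *m map_mx intr x) (s i) 0.
  by rewrite !ZE rmorphM /= tc Wxc.
have Uxr (x : 'cV[int]_n) i : (U *m map_mx intr x) i 0 \is Num.real.
  by rewrite CrealE UE rmorphD !rmorphM /= !Zxc sK conjCK addrC.
have Ur k j : U k j \is Num.real.
  have := Uxr (delta_mx j 0) k; rewrite map_delta_mx -colE.
  by rewrite mxE.
have detU : \det U = \det M * \det W.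
  rewrite /U /Z !det_mulmx det_diag; congr (_ * _).
  by under eq_bigr do rewrite mxE; rewrite tprod mul1r.
have uU : U \in unitmx.
  rewrite unitmxE detU unitrM -(unitmxE W) uW andbT unitfE.
  by rewrite -normr_gt0 detM ltr01.
have [|x x0 Ux1] := Minkowski_cube (ltnW n1) Ur uU.
  by rewrite detU normrM detM mul1r.
pose z i := (Z *m map_mx intr x) i 0; pose u i := (U *m map_mx intr x) i 0.
have uE i : u i = a * z i + a^* * (z i)^* by rewrite /u UE /z Zxc.
have usE i : u (s i) = a * (z i)^* + a^* * z i by rewrite uE /z -Zxc conjCK.
have u1 i : u i ^+ 2 <= 1.
  by rewrite -real_normK ?Uxr // expr_le1 ?Ux1.
have uu i : u i ^+ 2 + u (s i) ^+ 2 = 2 * `|z i| ^+ 2.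
  rewrite normCK uE usE; move: (z i) (z i)^* => w w'.
  transitivity ((a ^+ 2 + a^* ^+ 2) * (w ^+ 2 + w' ^+ 2) + 4 * (a * a^*) * (w * w')).
    by ring.
  by rewrite a2 aa; field.
have z1 i : 0 <= `|z i| <= 1.
  rewrite normr_ge0 -(@expr_le1 _ 2) ?normr_ge0 //.
  rewrite -(ler_pM2l (ltr0Sn _ 1)) -uu mulr1 -[2%:R]/(1 + 1) lerD ?u1 //.
(* All |z i| are at most 1, while their product is the absolute value of the norm form, as the t i
   have product 1, and so is at least 1. *)
have zi0 : `|z i0| = 1.
  apply: (prod_le1_eq1 (F := fun i => `|z i|)) => //.
  rewrite -normr_prod; under eq_bigr do rewrite /z ZE.
  by rewrite big_split /= tprod mul1r normW.
have zc : z i0 * (z i0)^* = 1 by rewrite -normCK zi0 expr1n.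
have [ue1 us1] : u i0 ^+ 2 = 1 /\ u (s i0) ^+ 2 = 1.
  have := uu i0; rewrite zi0 expr1n mulr1 => e.
  split; apply/eqP; rewrite eq_le u1 /=.
    by rewrite -(lerD2r (u (s i0) ^+ 2)) e lerD2l u1.
  by rewrite -(lerD2l (u i0 ^+ 2)) e lerD2r u1.
(* Both real forms have square 1 at i0, so their product Re(z^2) is 1 or -1; as |z| = 1, z is a
   fourth root of unity. *)
have z4 : z i0 ^+ 4 = 1.
  have : (u i0 * u (s i0)) ^+ 2 = 1 by rewrite exprMn ue1 us1 mulr1.
  rewrite uE usE; move: zc; move: (z i0) (z i0)^* => w w' ww.
  have -> : (a * w + a^* * w') * (a * w' + a^* * w)
    = (a ^+ 2 + a^* ^+ 2) * (w * w') + a * a^* * (w ^+ 2 + w' ^+ 2) by ring.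
  rewrite a2 aa ww mul0r add0r => e; apply/eqP; rewrite -subr_eq0 -sqrf_eq0; apply/eqP.
  have -> : (w ^+ 4 - 1) ^+ 2 = w ^+ 4 * (4 * (2^-1 * (w ^+ 2 + w' ^+ 2)) ^+ 2 - 4)
     - 2 * w ^+ 4 * ((w * w') ^+ 2 - 1) - ((w * w') ^+ 4 - 1) by field.
  by rewrite e ww; ring.
move/negP: ti0; apply.
have t0 : t i0 != 0.
  by apply: contra_eq_neq zc => /eqP; rewrite /z ZE => /eqP->; rewrite !mul0r eq_sym oner_eq0.
(* Since z = t (W x) and the inverse of z is z^3, the inverse of t is a product of algebraic
   integers, against the choice of i0. *)
have -> : (t i0)^-1 = (W *m map_mx intr x) i0 0 * z i0 ^+ 3.
  apply: (mulfI t0); rewrite mulfV // mulrA -ZE -[(Z *m _) i0 0]/(z i0) -exprS z4 //.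
rewrite rpredM //.
  by rewrite mxE rpred_sum // => k _; rewrite rpredM // mxE Aint_int.
by rewrite rpredX // (@Aint_unity_root 4) //; apply/unity_rootP.
Qed.

(** * Automorphisms and Galois action *)

(** The automorphism is found in the splitting field of the minimal polynomial, a normal extension
    of Q inside [algC], and then extended to [algC]. *)
Lemma minCpoly_conjugate (x y : algC) :
  root (minCpoly x) y -> exists sigma : {rmorphism algC -> algC}, sigma x = y.
Proof.
have [r [Dr mon_r] dv_r] := minCpolyP x.
have [s Ds] := closed_field_poly_normal (minCpoly x).
have {}Ds : minCpoly x = \prod_(z <- s) ('X - z%:P).
  by rewrite Ds (monicP (minCpoly_monic x)) scale1r.
have xs : x \in s by rewrite -root_prod_XsubC -Ds root_minCpoly.
rewrite Ds root_prod_XsubC => ys.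
have [Qs [QsC [s1 Ds1 genQs]]] := num_field_exists s.
pose p : {poly Qs} := map_poly (in_alg Qs) r.
have QsCp (q : {poly rat}) : map_poly QsC (map_poly (in_alg Qs) q) = map_poly ratr q.
  by rewrite -map_poly_comp; apply: eq_map_poly => b /=; rewrite alg_num_field fmorph_rat.
have Dp : p = \prod_(z <- s1) ('X - z%:P).
  apply: (map_poly_inj QsC); rewrite QsCp -Dr Ds -Ds1 big_map rmorph_prod.
  by apply: eq_bigr => z _; rewrite /= map_polyXsubC.
have splitp : splittingFieldFor 1 p {:Qs} by exists s1; rewrite // Dp eqpxx.
have Qs_ax : FieldExt_isSplittingField _ Qs.
  by constructor; exists p => //; apply/polyOver1P; exists r.
pose Qn : splittingFieldType rat := HB.pack_for (splittingFieldType rat) Qs Qs_ax.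
pose QnC : {rmorphism Qn -> algC} := QsC.
move: xs ys; rewrite -Ds1 => /mapP[x1 _ Dx] /mapP[y1 y1s Dy].
have rt : root (minPoly (1%AS : {subfield Qn}) (x1 : Qn)) (y1 : Qn).
  have /polyOver1P[q Dq] := minPolyOver (1%AS : {subfield Qn}) (x1 : Qn).
  rewrite Dq -(fmorph_root QnC) QsCp -[QnC y1]/(QsC y1) -Dy.
  have : root (map_poly ratr q) x.
    by rewrite Dx -QsCp -Dq fmorph_root (root_minPoly (1%AS : {subfield Qn})).
  rewrite dv_r => /dvdpP[q' ->]; rewrite rmorphM rootM /= -Dr Ds.
  by rewrite root_prod_XsubC -Ds1 Dy map_f // orbT.
have [nu _ Dnu] := normalField_root_minPoly (sub1v _) (normalFieldf 1%AS) (memvf _) rt.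
have [sigma Dsigma] := extend_algC_subfield_aut QnC nu.
exists sigma; rewrite Dx Dy -[QsC x1]/(QnC x1) -Dsigma.
by congr (QsC _); exact: Dnu.
Qed.

(** Every root of the minimal polynomial is conjugate to x, hence equal to x, so a rational
    coefficient is a nonzero multiple of x. *)
Lemma aut_fixed_rat (x : algC) :
  (forall sigma : {rmorphism algC -> algC}, sigma x = x) -> x \in Crat.
Proof.
move=> fix_x; have [r [Dr mon_r] dv_r] := minCpolyP x.
have [s Ds] := closed_field_poly_normal (minCpoly x).
have {}Ds : minCpoly x = \prod_(z <- s) ('X - z%:P).
  by rewrite Ds (monicP (minCpoly_monic x)) scale1r.
have sx z : z \in s -> z = x.
  rewrite -root_prod_XsubC -Ds => /minCpoly_conjugate[sigma <-]; exact: fix_x.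
have s0 : s != [::].
  by apply: contraTneq (root_minCpoly x) => s0; rewrite Ds s0 big_nil root1.
have e : (minCpoly x)`_(size s).-1 = - (x * (size s)%:R).
  rewrite Ds coefPn_prod_XsubC ?size_eq0 //; congr (- _).
  by rewrite (eq_big_seq (fun=> x)) // big_const_seq count_predT iter_addr_0 mulr_natr.
have k0 : (size s)%:R != 0 :> algC by rewrite pnatr_eq0 size_eq0.
have Dx : x = - (ratr r`_(size s).-1) / (size s)%:R.
  by rewrite -coef_map -Dr e opprK mulfK.
by rewrite Dx rpred_div ?rpredN ?rpred_nat ?Crat_rat.
Qed.

(** * Subrings and subfields of the algebraic numbers *)

Definition subring_of_algC (S : algC -> Prop) : Prop :=
  S 1 /\ (forall x y, S x -> S y -> S (x - y)) /\ (forall x y, S x -> S y -> S (x * y)).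

Section SubringClosure.

Variable S : algC -> Prop.
Hypothesis subS : subring_of_algC S.

Lemma subring1 : S 1. Proof. by case: subS. Qed.
Lemma subringB x y : S x -> S y -> S (x - y). Proof. by case: subS => _ [+ _]; apply. Qed.
Lemma subringM x y : S x -> S y -> S (x * y). Proof. by case: subS => _ [_]; apply. Qed.
Lemma subring0 : S 0. Proof. by rewrite -(subrr 1); apply: subringB subring1 subring1. Qed.
Lemma subringN x : S x -> S (- x).
Proof. by move=> Sx; rewrite -sub0r; apply: subringB subring0 _. Qed.
Lemma subringD x y : S x -> S y -> S (x + y).
Proof. by move=> Sx /subringN; rewrite -{2}[y]opprK; apply: subringB. Qed.
Lemma subringX x n : S x -> S (x ^+ n).
Proof.
by move=> Sx; elim: n => [|n IHn]; rewrite ?exprS; [exact: subring1 | exact: subringM].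
Qed.
Lemma subring_nat n : S n%:R.
Proof. by elim: n => [|n IHn]; [exact: subring0 | rewrite -natr1; apply: subringD subring1]. Qed.
Lemma subring_int (z : int) : S z%:~R.
Proof. by case: z => n; [|rewrite NegzE rmorphN; apply: subringN]; exact: subring_nat. Qed.
Lemma subring_sum (I : eqType) (r : seq I) (P : pred I) (F : I -> algC) :
  (forall i, i \in r -> P i -> S (F i)) -> S (\sum_(i <- r | P i) F i).
Proof.
move=> SF; rewrite big_seq_cond; elim/big_ind: _ => [|x y|i /andP[ri Pi]].
- exact: subring0.
- exact: subringD.
- exact: SF.
Qed.
Lemma subring_prod (I : eqType) (r : seq I) (P : pred I) (F : I -> algC) :
  (forall i, i \in r -> P i -> S (F i)) -> S (\prod_(i <- r | P i) F i).
Proof.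
move=> SF; rewrite big_seq_cond; elim/big_ind: _ => [|x y|i /andP[ri Pi]].
- exact: subring1.
- exact: subringM.
- exact: SF.
Qed.
Lemma subring_horner (p : {poly int}) x : S x -> S (map_poly intr p).[x].
Proof.
move=> Sx; rewrite horner_coef -(big_mkord xpredT (fun i => (map_poly intr p)`_i * x ^+ i)).
apply: subring_sum => i _ _; apply: subringM; last exact: subringX.
by rewrite coef_map; exact: subring_int.
Qed.

End SubringClosure.

Lemma subfield_subring (S : algC -> Prop) : subfield_of_algC S -> subring_of_algC S.
Proof. by case=> [S1 [SB [SM _]]]. Qed.

Lemma subfieldV (S : algC -> Prop) x : subfield_of_algC S -> S x -> S x^-1.
Proof. by case=> _ [_ [_]]; apply. Qed.

Lemma inL_subfield (r : nat) (alpha : 'I_r -> algC) : subfield_of_algC (inL alpha).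
Proof.
split; first by move=> S [].
split=> [x y Lx Ly S sS Sa|].
  by apply: (subringB (subfield_subring sS)); [exact: Lx | exact: Ly].
split=> [x y Lx Ly S sS Sa|x Lx S sS Sa]; last by apply: (subfieldV sS); exact: Lx.
by apply: (subringM (subfield_subring sS)); [exact: Lx | exact: Ly].
Qed.

Lemma inL_subring (r : nat) (alpha : 'I_r -> algC) : subring_of_algC (inL alpha).
Proof. exact: subfield_subring (inL_subfield alpha). Qed.

Lemma inL_gen (r : nat) (alpha : 'I_r -> algC) i : inL alpha (alpha i).
Proof. by move=> S _; apply. Qed.

Lemma fix_subfield (sigma tau : {rmorphism algC -> algC}) :
  subfield_of_algC (fun x => sigma x = tau x).
Proof.
split; first by rewrite !rmorph1.
by split=> [x y|]; last split=> [x y|x]; rewrite ?rmorphB ?rmorphM ?fmorphV /= => -> // ->.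
Qed.

Lemma preim_subfield (sigma : {rmorphism algC -> algC}) (S : algC -> Prop) :
  subfield_of_algC S -> subfield_of_algC (fun x => S (sigma x)).
Proof.
move=> sS; split; first by rewrite rmorph1; case: sS.
split=> [x y|]; last split=> [x y|x]; rewrite ?rmorphB ?rmorphM ?fmorphV /=.
- exact: subringB (subfield_subring sS) _ _.
- exact: subringM (subfield_subring sS) _ _.
- exact: subfieldV.
Qed.

Lemma eq_aut_inL (r : nat) (alpha : 'I_r -> algC) (sigma tau : {rmorphism algC -> algC}) x :
  (forall i, sigma (alpha i) = tau (alpha i)) -> inL alpha x -> sigma x = tau x.
Proof. by move=> eq_a /(_ (fun y => sigma y = tau y) (fix_subfield _ _)); apply. Qed.

(** * The Galois group as permutations of a stable family of roots *)

Section GaloisAction.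

Variables (m : nat) (rho : 'I_m -> algC).
Hypothesis rho_inj : injective rho.
Hypothesis rho_closed : forall (sigma : {rmorphism algC -> algC}) i,
  exists j, sigma (rho i) = rho j.

Definition acts_as (s : 'S_m) (sigma : {rmorphism algC -> algC}) : Prop :=
  forall i, sigma (rho i) = rho (s i).

(** The Galois group of the field K generated by the rho i. Encoding its elements as permutations of
    the indices makes finite group theory available; excluded middle turns the existence of an
    automorphism into a boolean. *)
Definition aut_set : {set 'S_m} :=
  [set s | if excluded_middle_informative (exists sigma, acts_as s sigma)
           then true else false].

(** Only the restriction to K is determined by s, so identities between these automorphisms hold on
    K alone. *)
Definition gaut (s : 'S_m) : {rmorphism algC -> algC} :=
  epsilon (inhabits (idfun : {rmorphism algC -> algC})) (acts_as s).

Lemma aut_setP s : reflect (exists sigma, acts_as s sigma) (s \in aut_set).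
Proof. by rewrite inE; case: excluded_middle_informative => ex; constructor. Qed.

Lemma gautE s i : s \in aut_set -> gaut s (rho i) = rho (s i).
Proof. by move/aut_setP/(epsilon_spec (inhabits (idfun : {rmorphism algC -> algC}))). Qed.

Lemma aut_group_set : group_set aut_set.
Proof.
apply/group_setP; split=> [|s t /aut_setP[sigma Ds] /aut_setP[tau Dt]].
  by apply/aut_setP; exists idfun => i; rewrite perm1.
by apply/aut_setP; exists (tau \o sigma) => i; rewrite /= Ds Dt permM.
Qed.

Definition autG : {group 'S_m} := group aut_group_set.

Notation K := (inL rho).

Lemma inK_aut (sigma : {rmorphism algC -> algC}) x : K x -> K (sigma x).
Proof.
move=> Kx; apply: (Kx (fun y => K (sigma y))); first exact: preim_subfield (inL_subfield _).
by move=> i; have [j ->] := rho_closed sigma i; exact: inL_gen.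
Qed.

Lemma gaut_exists (sigma : {rmorphism algC -> algC}) :
  exists2 s, s \in autG & forall x, K x -> gaut s x = sigma x.
Proof.
have [h hP] := fin_all_exists (rho_closed sigma).
have h_inj : injective h.
  by move=> i j eq_h; apply/rho_inj/(fmorph_inj sigma); rewrite !hP eq_h.
have sG : perm h_inj \in aut_set.
  by apply/aut_setP; exists sigma => i; rewrite hP permE.
exists (perm h_inj) => // x; apply: eq_aut_inL => i.
by rewrite gautE // permE hP.
Qed.

Lemma gautM s t x : s \in autG -> t \in autG -> K x -> gaut (s * t)%g x = gaut t (gaut s x).
Proof.
move=> sG tG; apply: (eq_aut_inL (tau := gaut t \o gaut s)) => i /=.
by rewrite !gautE ?groupM ?permM //; apply: (groupM sG tG).
Qed.

Lemma gaut1 x : K x -> gaut 1%g x = x.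
Proof.
apply: (eq_aut_inL (tau := idfun)) => i /=.
by rewrite gautE ?perm1 //; exact: (group1 autG).
Qed.

Lemma gal_fixed_rat x : K x -> (forall s, s \in autG -> gaut s x = x) -> x \in Crat.
Proof.
move=> Kx fix_x; apply: aut_fixed_rat => sigma.
by have [s sG <-] := gaut_exists sigma; rewrite ?fix_x.
Qed.

Lemma gal_fixed_int x :
  K x -> x \in Aint -> (forall s, s \in autG -> gaut s x = x) -> x \in Num.int.
Proof. by move=> Kx Ax fix_x; rewrite Cint_rat_Aint ?gal_fixed_rat. Qed.

End GaloisAction.

(** * Unramified extensions of Q *)

Section CosetTrace.

Variables (m : nat) (rho : 'I_m -> algC).
Hypothesis rho_inj : injective rho.
Hypothesis rho_closed : forall (sigma : {rmorphism algC -> algC}) i,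
  exists j, sigma (rho i) = rho j.

Notation G := (autG rho).
Notation K := (inL rho).
Implicit Type H : {group 'S_m}.

Definition fixed_by (H : {set 'S_m}) (x : algC) : Prop :=
  forall h, h \in H -> gaut rho h x = x.

(** The relative trace from the fixed field of H1 to that of H when H1 is a subgroup of H. Products
    of permutations act from left to right, so it is the right cosets of H1 that have a well defined
    effect on elements fixed by H1. *)
Definition coset_trace (H1 H : {set 'S_m}) (y : algC) : algC :=
  \sum_(C in rcosets H1 H) gaut rho (repr C) y.

Lemma gaut_rcoset H g g' y : H \subset G -> g \in G -> g' \in (H :* g)%g -> K y ->
  fixed_by H y -> gaut rho g' y = gaut rho g y.
Proof.
move=> sHG gG /rcosetP[h hH ->] Ky fixy.
by rewrite gautM ?(subsetP sHG h hH) ?(fixy h hH).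
Qed.

Lemma repr_rcosets (H1 : {group 'S_m}) H C : H1 \subset H -> C \in rcosets H1 H ->
  repr C \in H /\ C = (H1 :* repr C)%g.
Proof.
move=> sH /rcosetsP[g gH ->].
have /rcosetP[h hH1 e] := mem_repr_rcoset H1 g.
rewrite e groupM ?(subsetP sH h hH1) //; split=> //.
by rewrite rcosetM (rcoset_id hH1).
Qed.

Lemma coset_trace_fixed (H1 : {group 'S_m}) H y : H1 \subset H -> H \subset G -> K y ->
  fixed_by H1 y -> fixed_by H (coset_trace H1 H y).
Proof.
move=> sH1 sH Ky fixy h hH; have hG := subsetP sH h hH.
have sH1G := subset_trans sH1 sH.
rewrite /coset_trace rmorph_sum /=.
rewrite [RHS](reindex_onto (fun C => C :* h)%g (fun C => C :* h^-1)%g) /=; last first.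
  by move=> C _; rewrite -rcosetM mulVg rcoset1.
apply: eq_big => [C|C CH].
  rewrite -rcosetM mulgV rcoset1 eqxx andbT; apply/rcosetsP/rcosetsP => [[g gH ->]|[g gH e]].
    by exists (g * h)%g; rewrite ?groupM // rcosetM.
  by exists (g * h^-1)%g; rewrite ?groupM ?groupV // rcosetM -e -rcosetM mulgV rcoset1.
have [rH eC] := repr_rcosets sH1 CH; have rG := subsetP sH _ rH.
rewrite -gautM //; symmetry; apply: (gaut_rcoset (H := H1)); rewrite ?groupM //.
by move: (repr C) eC => c ->; rewrite -rcosetM mem_repr_rcoset.
Qed.

Lemma coset_traceK (H1 : {group 'S_m}) H y :
  H1 \subset H -> H \subset G -> K y -> K (coset_trace H1 H y).
Proof. by move=> *; apply: (subring_sum (inL_subring rho)) => *; apply: inK_aut. Qed.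

Lemma coset_trace_Aint H1 H y : y \in Aint -> coset_trace H1 H y \in Aint.
Proof. by move=> Ay; apply: rpred_sum => C _; rewrite Aint_aut. Qed.

Lemma coset_trace_int H y : H \subset G -> K y -> y \in Aint -> fixed_by H y ->
  coset_trace H G y \in Num.int.
Proof.
move=> sH Ky Ay fixy; apply: (gal_fixed_int rho_inj rho_closed).
- exact: coset_traceK.
- exact: coset_trace_Aint.
- exact: coset_trace_fixed.
Qed.

(* [sep S H c] : the function sending g to c on H and to 0 off H is of the form
   sum_k a_k g(b_k), with a_k in S and b_k integral over Z and fixed by H. When
   H is the Galois group of K over F and c = 1, this says that F is unramified. *)
Definition separating_family (H : {set 'S_m}) (c : algC) (s : seq (algC * algC)) : Prop :=
  (forall p, p \in s -> [/\ K p.1, K p.2, p.2 \in Aint & fixed_by H p.2]) /\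
  (forall g, g \in G -> \sum_(p <- s) p.1 * gaut rho g p.2 = c * (g \in H)%:R).

Definition sep (S : algC -> Prop) (H : {set 'S_m}) (c : algC) : Prop :=
  exists2 s, separating_family H c s & forall p, p \in s -> S p.1.

(** Products of the two sums are again such sums, and the indicator functions of H1 and H2 multiply
    to that of the intersection. On fields this is the passage to a compositum. *)
Lemma sep_mul (S : algC -> Prop) (H1 H2 : {set 'S_m}) c1 c2 :
    (forall x y, S x -> S y -> S (x * y)) ->
  sep S H1 c1 -> sep S H2 c2 -> sep S (H1 :&: H2) (c1 * c2).
Proof.
move=> SM [s1 [fam1 sum1] Ss1] [s2 [fam2 sum2] Ss2].
exists [seq (p.1 * q.1, p.2 * q.2) | p <- s1, q <- s2]; last first.
  by move=> _ /allpairsP[[p q] [/= /Ss1 ? /Ss2 ? ->]]; apply: SM.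
split=> [_ /allpairsP[[p q] [/= ps qs ->]]|g gG] /=.
  have [K1 K2 A2 F2] := fam1 _ ps; have [K1' K2' A2' F2'] := fam2 _ qs.
  split; [exact: (subringM (inL_subring rho)) | exact: (subringM (inL_subring rho)) | |].
    by rewrite rpredM.
  by move=> h; rewrite inE => /andP[h1 h2]; rewrite rmorphM /= F2 ?F2'.
rewrite inE -mulnb natrM mulrACA -sum1 // -sum2 // big_allpairs_dep mulr_suml.
apply: eq_bigr => p _; rewrite mulr_sumr; apply: eq_bigr => q _.
by rewrite /= rmorphM mulrACA.
Qed.

Lemma sep_lin (S : algC -> Prop) H c1 c2 u1 u2 :
    (forall x y, S x -> S y -> S (x * y)) -> S u1 -> S u2 -> K u1 -> K u2 ->
  sep S H c1 -> sep S H c2 -> sep S H (u1 * c1 + u2 * c2).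
Proof.
move=> SM Su1 Su2 Ku1 Ku2 [s1 [fam1 sum1] Ss1] [s2 [fam2 sum2] Ss2].
pose scale u := map (fun p : algC * algC => (u * p.1, p.2)).
exists (scale u1 s1 ++ scale u2 s2); last first.
  by move=> p; rewrite mem_cat => /orP[]/mapP[q qs ->] /=; apply: SM => //; auto.
split=> [p|g gG].
  rewrite mem_cat => /orP[]/mapP[q qs ->] /=.
    have [? ? ? ?] := fam1 _ qs; split=> //.
    exact: (subringM (inL_subring rho)).
  have [? ? ? ?] := fam2 _ qs; split=> //.
  exact: (subringM (inL_subring rho)).
rewrite big_cat !big_map /= mulrDl -!mulrA -sum1 // -sum2 // !mulr_sumr.
by congr (_ + _); apply: eq_bigr => p _; rewrite mulrA.
Qed.

(** Replacing each b by its trace sums the conditions (repr C) g in H1 over the cosets C of H1 in H: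
    exactly one holds if g is in H, and none otherwise. With c = 1 this says that subfields of
    unramified fields are unramified. *)
Lemma sep_trace (S : algC -> Prop) (H1 H : {group 'S_m}) c :
  H1 \subset H -> H \subset G -> sep S H1 c -> sep S H c.
Proof.
move=> sH1 sH [s [fam sum] Ss].
exists (map (fun p : algC * algC => (p.1, coset_trace H1 H p.2)) s); last first.
  by move=> q /mapP[p ps ->] /=; exact: Ss.
split=> [_ /mapP[p ps ->]|g gG] /=.
  have [K1 K2 A2 F2] := fam _ ps; split=> //.
  - exact: coset_traceK.
  - exact: coset_trace_Aint.
  - exact: coset_trace_fixed.
have rcG C : C \in rcosets H1 H -> repr C \in G.
  by move=> CH; have [/(subsetP sH)] := repr_rcosets sH1 CH.
transitivity (\sum_(C in rcosets H1 H) c * ((repr C * g)%g \in H1)%:R).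
  rewrite big_map /coset_trace.
  under eq_bigr => p _ do rewrite rmorph_sum mulr_sumr /=.
  rewrite exchange_big /=; apply: eq_bigr => C CH.
  rewrite -sum ?groupM ?rcG //.
  rewrite big_seq [RHS]big_seq; apply: eq_bigr => p ps.
  by have [? ? ? ?] := fam _ ps; rewrite gautM ?rcG.
have [gH|gNH] := boolP (g \in H); last first.
  rewrite [RHS]mulr0 big1 // => C CH; have [rH _] := repr_rcosets sH1 CH.
  have [rg|_] := boolP (_ \in H1); last exact: mulr0; case/negP: gNH.
  by rewrite -(groupMl _ rH) (subsetP sH1).
have C0H : (H1 :* g^-1)%g \in rcosets H1 H by rewrite mem_rcosets mulSGid ?groupV.
rewrite (bigD1 _ C0H) /= big1 ?addr0 => [|C /andP[CH neC]].
  by have /rcosetP[h hH ->] := mem_repr_rcoset H1 g^-1%g; rewrite mulgKV hH.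
have [rg|_] := boolP (_ \in H1); last exact: mulr0; case/eqP: neC.
have [rH ->] := repr_rcosets sH1 CH.
by apply: rcoset_eqP; rewrite mem_rcoset invgK.
Qed.

(** Expanding the traces yields the sum of c [g in H] g(x) over coset representatives g, of which
    only the term of H itself survives. So the a and the b are dual to each other for the trace
    form, up to c. *)
Lemma separating_expand H c s x :
    H \subset G -> separating_family H c s -> K x -> fixed_by H x ->
  c * x = \sum_(p <- s) p.1 * coset_trace H G (p.2 * x).
Proof.
move=> sH [fam sum] Kx fixx.
have rcG C : C \in rcosets H G -> repr C \in G.
  by move=> CH; have [] := repr_rcosets sH CH.
transitivity (\sum_(C in rcosets H G) c * (repr C \in H)%:R * gaut rho (repr C) x).
  have HC : (H : {set _}) \in rcosets H G.
    by apply/rcosetsP; exists 1%g; rewrite ?group1 ?rcoset1.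
  have rH : repr H \in H by apply: mem_repr (group1 H).
  rewrite (bigD1 _ HC) /= rH mulr1 fixx // big1 ?addr0 // => C /andP[CH neC].
  have [rCG eC] := repr_rcosets sH CH.
  have [rCH|_] := boolP (_ \in H); last by rewrite mulr0 mul0r.
  case/eqP: neC.
  by rewrite eC rcoset_id.
transitivity (\sum_(C in rcosets H G) \sum_(p <- s) p.1 * gaut rho (repr C) (p.2 * x)).
  apply: eq_bigr => C CH; rewrite -sum ?rcG // mulr_suml; apply: eq_bigr => p _.
  by rewrite rmorphM mulrA.
by rewrite exchange_big; apply: eq_bigr => p _; rewrite /coset_trace mulr_sumr.
Qed.

End CosetTrace.

Lemma rat_mx_clear_denom (m n : nat) (P : 'M[rat]_(m, n)) :
  exists2 c : int, c != 0 & exists Q : 'M[int]_(m, n), map_mx intr Q = c%:~R *: P.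
Proof.
exists (\prod_i \prod_j denq (P i j)).
  by apply/prodf_neq0 => i _; apply/prodf_neq0 => j _; rewrite denq_neq0.
have key i j : exists z : int, z%:~R = (\prod_i \prod_j denq (P i j))%:~R * P i j.
  rewrite (bigD1 i) //= (bigD1 j) //=; set u := \prod_(k | _) _; set v := \prod_(k | _) _.
  exists (u * v * numq (P i j)); rewrite -[X in _ = _ * X](divq_num_den (P i j)) !rmorphM /=.
  have := denq_neq0 (P i j); rewrite -(intr_eq0 rat); set e := (denq _)%:~R => e0.
  by field.
have [q qP] := fin_all_exists (fun i => fin_all_exists (key i)).
by exists (\matrix_(i, j) q i j); apply/matrixP => i j; rewrite !mxE qP.
Qed.

(* The column space of P meets Z^m in a direct summand, of which the columns of X
   form a basis. *)
Lemma rat_idempotent_basis (m : nat) (P : 'M[rat]_m) : P *m P = P ->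
  exists (X : 'M[int]_(m, \rank P)) (Y : 'M[int]_(\rank P, m)),
    Y *m X = 1%:M /\ P *m map_mx intr X = map_mx intr X.
Proof.
move=> PP; have [c c0 [Q DQ]] := rat_mx_clear_denom P.
case: (int_Smith_normal_form Q) => L uL [R uR [d sd defQ]].
pose dd (i : nat) : int := d`_i.
set D := \matrix_(i, j) _ in defQ; set r := \rank P.
have rm : (r <= m)%N := rank_leq_row P.
have cQ : c%:~R != 0 :> rat by rewrite intr_eq0.
(* By divisibility everything after a zero invariant is zero, so a zero among the first r would make
   the rank of Q, which is r, smaller than r. *)
have d_neq0 (j : nat) : (j < r)%N -> dd j != 0.
  move=> jr; apply/negP => /eqP dj0; move: jr; rewrite ltnNge => /negP; apply.
  have d0 k : (j <= k)%N -> dd k = 0.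
    move=> jk; have [kd|dk] := ltnP k (size d); last by rewrite /dd nth_default.
    apply/eqP; rewrite -dvd0z -{1}dj0.
    exact: (sorted_leq_nth dvdz_trans dvdzz 0 sd _ _ (leq_ltn_trans jk kd) kd jk).
  have DE : D = pid_mx j *m D.
    apply/matrixP => i k; rewrite [in RHS]mxE (bigD1 i) //= !mxE eqxx.
    rewrite big1 ?addr0 => [|l ne]; last first.
      by rewrite !mxE (inj_eq val_inj) eq_sym (negPf ne) mul0r.
    by case: ltnP => [_|ji]; rewrite ?mul1r // mul0r -[d`_i]/(dd i) d0 ?mul0rn.
  rewrite /r -(mxrank_scale_nz _ cQ) -DQ defQ !map_mxM.
  rewrite (leq_trans (mxrankM_maxl _ _)) // (leq_trans (mxrankM_maxr _ _)) //.
  rewrite DE map_mxM map_pid_mx (leq_trans (mxrankM_maxl _ _)) //.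
  have [jm|mj] := leqP j m; first by rewrite rank_pid_mx.
  by rewrite (leq_trans (rank_leq_row _)) // ltnW.
pose w (j : 'I_r) : 'I_m := widen_ord rm j.
exists (\matrix_(i, j) L i (w j)), (\matrix_(i, j) invmx L (w i) j).
split.
  apply/matrixP => i j; have := congr1 (fun A : 'M_m => A (w i) (w j)) (mulVmx uL).
  have ww : (w i == w j) = (i == j) by [].
  rewrite !mxE ww => <-.
  by apply: eq_bigr => k _; rewrite !mxE.
apply/matrixP => i j.
pose e : 'cV[rat]_m := delta_mx (w j) 0.
(* The j-th column of L is Q applied to a vector, divided by the j-th invariant; hence it lies in
   the image of the idempotent P. *)
have Lcol : map_mx intr L *m e = P *m
     ((c%:~R / (dd j)%:~R) *: (map_mx intr (invmx R) *m e)).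
  have dj : (dd j)%:~R != 0 :> rat by rewrite intr_eq0 d_neq0.
  apply: (scalerI dj); rewrite -scalemxAr scalerA mulrCA mulfV // mulr1 [RHS]scalemxAl -DQ.
  have LDR : Q *m invmx R = L *m D by rewrite defQ mulmxK.
  rewrite mulmxA -map_mxM LDR map_mxM -mulmxA scalemxAr; congr (_ *m _).
  apply/matrixP => k l; rewrite /e -colE !mxE.
  rewrite ord1 eqxx andbT (inj_eq val_inj).
  by case: eqP => [->|_]; rewrite ?mulr1n ?mulr1 // mulr0n mulr0.
have : P *m (map_mx intr L *m e) = map_mx intr L *m e.
  by rewrite Lcol mulmxA PP.
rewrite -colE => /(congr1 (fun A : 'cV_m => A i 0)); rewrite !mxE => <-.
by apply: eq_bigr => k _; rewrite !mxE.
Qed.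

Section Unramified.

Variables (m : nat) (rho : 'I_m -> algC).
Hypothesis rho_inj : injective rho.
Hypothesis rho_closed : forall (sigma : {rmorphism algC -> algC}) i,
  exists j, sigma (rho i) = rho j.

Notation G := (autG rho).
Notation K := (inL rho).
Variable H : {group 'S_m}.
Hypothesis sHG : H \subset G.

Let cs (i : 'I_#|rcosets H G|) : {set 'S_m} := enum_val i.

Definition coset_rep (i : 'I_#|rcosets H G|) : 'S_m := repr (enum_val i).

Let t := coset_rep.

Let tG i : t i \in G.
Proof. by have [] := repr_rcosets sHG (enum_valP i). Qed.

Let tcoset i : cs i = (H :* t i)%g.
Proof. by have [] := repr_rcosets sHG (enum_valP i). Qed.

Lemma coset_trace_reps y : coset_trace rho H G y = \sum_i gaut rho (t i) y.
Proof. by rewrite /coset_trace big_enum_val. Qed.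

(** An automorphism permutes the embeddings of the fixed field of H. This makes norms rational, and
    for complex conjugation it gives the pairing of the embeddings. *)
Lemma coset_reps_shift g : g \in G -> exists2 h : 'I_#|rcosets H G| -> 'I_#|rcosets H G|,
  injective h &
  forall i y, K y -> fixed_by rho H y -> gaut rho g (gaut rho (t i) y) = gaut rho (t (h i)) y.
Proof.
move=> gG.
have cG i : (cs i :* g)%g \in rcosets H G.
  by apply/rcosetsP; exists (t i * g)%g; rewrite ?groupM ?tG // tcoset rcosetM.
exists (fun i => enum_rank_in (cG i) (cs i :* g)%g).
  move=> i j /(congr1 enum_val); rewrite !enum_rankK_in // => e.
  by apply: enum_val_inj; apply: (can_inj (rcosetK g)); exact: e.
move=> i y Ky fixy; rewrite -gautM ?tG //; symmetry; apply: (gaut_rcoset (H := H)) => //.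
  by rewrite groupM ?tG.
rewrite rcosetM -tcoset /t /coset_rep enum_rankK_in // tcoset -rcosetM.
exact: mem_repr_rcoset.
Qed.

Lemma coset_norm_int y : K y -> y \in Aint -> fixed_by rho H y ->
  \prod_i gaut rho (t i) y \in Num.int.
Proof.
move=> Ky Ay fixy; apply: (gal_fixed_int rho_inj rho_closed).
- by apply: (subring_prod (inL_subring rho)) => i _ _; apply: inK_aut.
- by apply: rpred_prod => i _; rewrite Aint_aut.
move=> g gG; rewrite rmorph_prod; have [h h_inj hP] := coset_reps_shift gG.
rewrite [RHS](reindex_inj h_inj); apply: eq_bigr => i _; exact: hP.
Qed.

(** A nonzero integer combination of the v j has a nonzero norm, by invertibility of W, and this
    norm is an integer: it is the product of linear forms that has to be at least 1. *)
Lemma conjugate_mx_dim_le1 (v : 'I_#|rcosets H G| -> algC) :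
    (forall j, [/\ K (v j), v j \in Aint & fixed_by rho H (v j)]) ->
    let W := \matrix_(i, j) gaut rho (t i) (v j) in
  W \in unitmx -> `|\det W| <= 1 -> (#|rcosets H G| <= 1)%N.
Proof.
move=> vP W uW detW.
have [c cG cP] := gaut_exists rho_inj rho_closed Num.conj.
have [s _ sP] := coset_reps_shift cG.
apply: (norm_form_dim_le1 (W := W) (s := s)) => // [i j|i j|x x0].
- by rewrite mxE Aint_aut; have [] := vP j.
- by have [Kv _ fv] := vP j; rewrite !mxE -sP // cP //; apply: inK_aut.
pose y := \sum_j v j * (x j 0)%:~R.
have Wx i : (W *m map_mx intr x) i 0 = gaut rho (t i) y.
  rewrite mxE rmorph_sum; apply: eq_bigr => j _.
  by rewrite !mxE rmorphM rmorph_int.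
have Ky : K y.
  apply: (subring_sum (inL_subring rho)) => j _ _.
  apply: (subringM (inL_subring rho)); first by have [] := vP j.
  exact: (subring_int (inL_subring rho)).
have Ay : y \in Aint.
  by apply: rpred_sum => j _; rewrite rpredM ?Aint_int //; have [] := vP j.
have fixy : fixed_by rho H y.
  move=> h hH; rewrite rmorph_sum; apply: eq_bigr => j _.
  by rewrite rmorphM rmorph_int; have [_ _ ->] := vP j.
under eq_bigr do rewrite Wx.
apply: norm_intr_ge1; first exact: coset_norm_int.
apply/prodf_neq0 => i _; rewrite fmorph_eq0; apply: contra x0 => /eqP y0.
have : W *m map_mx intr x = 0.
  by apply/matrixP => k l; rewrite ord1 Wx y0 rmorph0 mxE.
move/(congr1 (mulmx (invmx W))); rewrite mulKmx // mulmx0 => /matrixP e.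
apply/eqP/matrixP => k l; have := e k l; rewrite !mxE => /eqP.
by rewrite intr_eq0 => /eqP.
Qed.

(** The b k generate but need not be independent. Their traces against a dual system form a rational
    idempotent matrix whose rank is the degree of the field; an integral basis of its image cuts
    both systems down to bases v, w with mutually inverse conjugate matrices. One of the two
    determinants is at most 1 in absolute value. *)
Lemma unramified_full : sep rho (fun x => x \in Aint) H 1 -> G \subset H.
Proof.
case=> s [fam sum] sA; pose d := size s.
pose a (k : 'I_d) := (nth (0, 0) s k).1; pose b (k : 'I_d) := (nth (0, 0) s k).2.
have sk (k : 'I_d) : nth (0, 0) s k \in s by rewrite mem_nth.
have Ka k : K (a k) by have [] := fam _ (sk k).
have Aa k : a k \in Aint by exact: sA.
have Kb k : K (b k) by have [] := fam _ (sk k).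
have Ab k : b k \in Aint by have [] := fam _ (sk k).
have fixb k : fixed_by rho H (b k) by have [] := fam _ (sk k).
have sumE (F : algC * algC -> algC) :
    \sum_(p <- s) F p = \sum_(k < d) F (a k, b k).
  rewrite (big_nth (0, 0)) big_mkord; apply: eq_bigr => k _.
  by rewrite /a /b -surjective_pairing.
(* Averaging over H makes the left factors fixed by H without changing the relation, at the price of
   their integrality. *)
pose a' k := #|H|%:R^-1 * \sum_(h in H) gaut rho h (a k).
have H0 : #|H|%:R != 0 :> algC by rewrite pnatr_eq0 -lt0n cardG_gt0.
have Ka' k : K (a' k).
  apply: (subringM (inL_subring rho)).
    by apply: (subfieldV (inL_subfield rho)); exact: (subring_nat (inL_subring rho)).
  by apply: (subring_sum (inL_subring rho)) => *; apply: inK_aut.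
have inG h : h \in H -> h \in G := subsetP sHG h.
have fixa' k : fixed_by rho H (a' k).
  move=> h hH; rewrite rmorphM fmorphV rmorph_nat rmorph_sum /=; congr (_ * _).
  rewrite [RHS](reindex_inj (mulIg h)) /=; apply: eq_big => [g|g gH].
    by rewrite groupMr.
  by rewrite gautM ?inG.
have sum_a' g : g \in G -> \sum_k a' k * gaut rho g (b k) = (g \in H)%:R.
  move=> gG; transitivity (#|H|%:R^-1 * \sum_(h in H) (g \in H)%:R : algC).
    under eq_bigr do rewrite /a' -mulrA mulr_suml.
    rewrite -mulr_sumr exchange_big /=; congr (_ * _); apply: eq_bigr => h hH.
    have := sum (g * h^-1)%g; rewrite groupM ?groupV ?(inG h) // => /(_ isT).
    move/(congr1 (gaut rho h)); rewrite sumE mul1r rmorph_nat groupMr ?groupV // => <-.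
    rewrite rmorph_sum; apply: eq_bigr => k _ /=.
    by rewrite rmorphM -gautM ?groupM ?groupV ?(inG h) ?mulgKV.
  by rewrite sumr_const -[X in _ * X]mulr_natl mulKf.
clearbody a'.
pose A := \matrix_(i, k) gaut rho (t i) (a' k).
pose B := \matrix_(i, k) gaut rho (t i) (b k).
(* t j (t i)^-1 lies in H only when the two cosets coincide. *)
have AB : A *m B^T = 1%:M.
  apply/matrixP => i j; rewrite !mxE.
  have gG : (t j * (t i)^-1)%g \in G by rewrite groupM ?groupV ?tG.
  transitivity (gaut rho (t i) (\sum_k a' k * gaut rho (t j * (t i)^-1)%g (b k))).
    rewrite rmorph_sum; apply: eq_bigr => k _; rewrite !mxE rmorphM /=.
    by rewrite -gautM ?tG // mulgKV.
  rewrite sum_a' // rmorph_nat; congr ((nat_of_bool _)%:R).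
  rewrite -mem_rcoset; apply/idP/eqP => [tij|->]; last exact: rcoset_refl.
  by apply: enum_val_inj; change (cs i = cs j); rewrite !tcoset; apply/esym/rcoset_eqP.
have PE k l : (B^T *m A) k l = coset_trace rho H G (b k * a' l).
  rewrite coset_trace_reps mxE; apply: eq_bigr => i _.
  by rewrite !mxE rmorphM.
have Prat k l : exists q : rat, (B^T *m A) k l = ratr q.
  apply/CratP; rewrite PE; apply: (gal_fixed_rat rho_inj rho_closed).
    by apply: coset_traceK => //; exact: (subringM (inL_subring rho)).
  apply: coset_trace_fixed => //; first exact: (subringM (inL_subring rho)).
  by move=> h hH; rewrite rmorphM /= fixb // fixa'.
have [q qP] := fin_all_exists (fun k => fin_all_exists (Prat k)).
pose P : 'M[rat]_d := \matrix_(k, l) q k l.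
have DP : map_mx ratr P = B^T *m A.
  by apply/matrixP => k l; rewrite [RHS]qP !mxE.
have PP : P *m P = P.
  apply: (map_mx_inj (f := ratr : {rmorphism rat -> algC})); rewrite map_mxM DP.
  by rewrite mulmxA -(mulmxA _ A) AB mulmx1.
have rP : \rank P = #|rcosets H G|.
  apply/eqP; rewrite eqn_leq -(mxrank_map (ratr : {rmorphism rat -> algC})) DP.
  rewrite mulmx_max_rank (mulmx1_min_rank (M := A) (N := B^T)) //.
  by rewrite !mulmxA AB mul1mx.
have [X [Y [YX PX]]] := rat_idempotent_basis PP.
rewrite rP in X Y YX PX.
pose XC : 'M[algC]_(d, _) := map_mx intr X; pose YC : 'M[algC]_(_, d) := map_mx intr Y.
have ratrC (p n : nat) (M : 'M[int]_(p, n)) :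
    map_mx ratr (map_mx intr M) = map_mx intr M :> 'M[algC]_(p, n).
  by apply/matrixP => i j; rewrite !mxE ratr_int.
have PXC : B^T *m A *m XC = XC.
  by rewrite -DP /XC -ratrC -map_mxM PX.
have YXC : YC *m XC = 1%:M by rewrite -map_mxM YX map_scalar_mx rmorph1.
pose w j := \sum_k a' k * XC k j; pose v j := \sum_k b k * YC j k.
(* Here integrality is recovered: a' is a P by the trace expansion and P fixes the columns of X, so
   the combinations of the averaged a' are also those of the integral a. *)
have wE j : w j = \sum_k a k * XC k j.
  have a'E l : a' l = \sum_k a k * (B^T *m A) k l.
    rewrite -[a' l]mul1r (separating_expand sHG (conj fam sum)) // sumE.
    by apply: eq_bigr => k _; rewrite PE.
  rewrite /w; under eq_bigr do rewrite a'E mulr_suml.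
  rewrite exchange_big; apply: eq_bigr => k _ /=.
  rewrite -[in RHS]PXC [in RHS]mxE mulr_sumr; apply: eq_bigr => l _.
  by rewrite mulrA.
have intK (z : int) : K z%:~R := subring_int (inL_subring rho) z.
have KM := subringM (inL_subring rho); have Ksum := subring_sum (inL_subring rho).
have wP j : [/\ K (w j), w j \in Aint & fixed_by rho H (w j)].
  split.
  - by apply: Ksum => k _ _; rewrite mxE; apply: KM.
  - by rewrite wE; apply: rpred_sum => k _; rewrite mxE rpredM ?Aint_int.
  move=> h hH; rewrite rmorph_sum; apply: eq_bigr => k _.
  by rewrite rmorphM /= fixa' // mxE rmorph_int.
have vP j : [/\ K (v j), v j \in Aint & fixed_by rho H (v j)].
  split.
  - by apply: Ksum => k _ _; rewrite mxE; apply: KM.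
  - by apply: rpred_sum => k _; rewrite mxE rpredM ?Aint_int.
  move=> h hH; rewrite rmorph_sum; apply: eq_bigr => k _.
  by rewrite rmorphM /= fixb // mxE rmorph_int.
have WE : \matrix_(i, j) gaut rho (t i) (w j) = A *m XC.
  apply/matrixP => i j; rewrite !mxE rmorph_sum; apply: eq_bigr => k _.
  by rewrite rmorphM !mxE rmorph_int.
have VE : \matrix_(i, j) gaut rho (t i) (v j) = (YC *m B^T)^T.
  apply/matrixP => i j; rewrite !mxE rmorph_sum; apply: eq_bigr => k _.
  by rewrite rmorphM !mxE rmorph_int mulrC.
have VW : (YC *m B^T) *m (A *m XC) = 1%:M.
  by rewrite mulmxA -(mulmxA YC) -mulmxA PXC YXC.
have [uV uW] := mulmx1_unit VW.
have le1 : (#|rcosets H G| <= 1)%N.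
  have := congr1 (fun M => `|\det M|) VW; rewrite det_mulmx det1 normr1 normrM => dVW.
  have [W1|W1] := real_leP (normr_real (\det (A *m XC))) (real1 _).
    by apply: (conjugate_mx_dim_le1 wP); rewrite WE.
  apply: (conjugate_mx_dim_le1 vP); rewrite VE ?unitmx_tr // det_tr.
  by rewrite -dVW ler_peMr // ltW.
have /eqP : #|G : H|%g = 1%N by apply/eqP; rewrite eqn_leq le1 indexg_gt0.
by rewrite indexg_eq1.
Qed.

End Unramified.

(** * Resultants and discriminants *)

Lemma det_row_perm_sign (R : comNzRingType) (n : nat) (s : 'S_n) (A : 'M[R]_n) :
  \det (row_perm s A) = (-1) ^+ s * \det A.
Proof. by rewrite row_permE det_mulmx det_perm. Qed.

Lemma det_Vandermonde_neq0 (F : idomainType) (d : nat) (x : 'rV[F]_d) :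
  injective (x 0) -> \det (Vandermonde d x) != 0.
Proof.
move=> xi; rewrite det_Vandermonde; apply/prodf_neq0 => i _; apply/prodf_neq0 => j ij.
by rewrite subr_eq0 (inj_eq xi) -val_eqE; have := gtn_eqF ij => ->.
Qed.

(* Multiply the Sylvester matrix by the columns that read off the coefficients of
   degree >= d and the values at the roots of p. *)
Lemma resultant_roots (F : fieldType) (d e : nat) (p q : {poly F}) (x : 'rV[F]_d) :
    size p = d.+1 -> size q = e.+1 -> injective (x 0) -> (forall i, root p (x 0 i)) ->
  exists b : bool, resultant p q = (-1) ^+ b * lead_coef p ^+ e * \prod_i q.[x 0 i].
Proof.
move=> sp sq xi px; rewrite /resultant.
move: (@Sylvester_mxE _ p q) => /=; move: (Sylvester_mx p q); rewrite sp sq /= => S SE.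
pose V := Vandermonde d x.
pose M : 'M[F]_(e + d) := \matrix_(k, j)
  match split j with inl l => ((k : nat) == d + l)%N%:R | inr i => x 0 i ^+ k end.
(* Puts the rows of degree at least d in front, which makes M block triangular with diagonal blocks
   1 and V. *)
pose h (i : 'I_(e + d)) : 'I_(e + d) := match split i with
  | inl l => cast_ord (addnC d e) (rshift d l) | inr k => cast_ord (addnC d e) (lshift e k) end.
have h_inj : injective h.
  move=> i j; rewrite /h; case: (split_ordP i) => k ->; case: (split_ordP j) => l -> /(congr1 val) /=.
  - by move/addnI => e1; congr (lshift _ _); exact: val_inj.
  - by move=> e1; have := ltn_ord l; rewrite -e1 ltnNge leq_addr.
  - by move=> e1; have := ltn_ord k; rewrite e1 ltnNge leq_addr.
  - by move=> e1; congr (rshift _ _); exact: val_inj.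
have detM : (-1) ^+ (perm h_inj) * \det M = \det V.
  rewrite -det_row_perm_sign.
  have -> : row_perm (perm h_inj) M = block_mx 1%:M (\matrix_(l, i) x 0 i ^+ (d + l)) 0 V.
    apply/matrixP => i j; rewrite [LHS]mxE [LHS]mxE permE /h.
    case: (split_ordP i) => k ->; case: (split_ordP j) => l ->.
    - by rewrite block_mxEul /= eqn_add2l mxE.
    - by rewrite block_mxEur mxE.
    - by rewrite block_mxEdl /= mxE ltn_eqF // ltn_addr.
    - by rewrite block_mxEdr mxE.
  by rewrite det_ublock det1 mul1r.
pose C := \matrix_(k < d, l < e) \sum_j S (rshift e k) j * M j (lshift d l).
pose T := \matrix_(k < e, l < e) (p`_(d + l - k) *+ (k <= d + l)%N).
have horner_shift (u : {poly F}) (k : nat) (y : F) : (size u + k <= e + d)%N ->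
    \sum_(j < e + d) u`_(j - k) *+ (k <= j)%N * y ^+ j = y ^+ k * u.[y].
  move=> le; transitivity (u * 'X^k).[y]; last by rewrite hornerM hornerXn mulrC.
  rewrite (@horner_coef_wide _ (e + d)) ?(leq_trans (size_polyMleq _ _)) ?size_polyXn ?addnS //.
  by apply: eq_bigr => j _; rewrite coefMXn ltnNge; case: leqP; rewrite ?mulr1n ?mulr0n.
have SM : S *m M = block_mx T 0 C (V *m diag_mx (\row_i q.[x 0 i])).
  apply/matrixP => i j; case: (split_ordP i) => k ->; case: (split_ordP j) => l ->.
  - have dl : (d + l < e + d)%N by rewrite addnC ltn_add2r.
    rewrite block_mxEul !mxE (bigD1 (Ordinal dl)) //= big1 => [|c ne]; last first.
      rewrite mxE; case: split_ordP => l' /eqP; rewrite ?eq_lshift ?eq_lrshift // => /eqP <-.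
      by rewrite -val_eqE /= in ne; rewrite (negPf ne) mulr0.
    rewrite addr0 SE !mxE; case: split_ordP => k' /eqP; rewrite ?eq_lshift ?eq_lrshift // => /eqP <-.
    case: split_ordP => l' /eqP; rewrite ?eq_lshift ?eq_lrshift // => /eqP <-.
    by rewrite /= eqxx mulr1.
  - rewrite block_mxEur !mxE.
    transitivity (x 0 l ^+ k * p.[x 0 l]); last by rewrite (rootP (px l)) mulr0.
    rewrite -horner_shift; last by rewrite sp; have := ltn_ord k; lia.
    apply: eq_bigr => c _; rewrite SE mxE.
    case: split_ordP => k' /eqP; rewrite ?eq_lshift ?eq_lrshift // => /eqP <-.
    by case: split_ordP => l' /eqP; rewrite ?eq_rshift ?eq_rlshift // => /eqP <-.
  - by rewrite block_mxEdl !mxE.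
  rewrite block_mxEdr mul_mx_diag !mxE -horner_shift; last by rewrite sq; have := ltn_ord k; lia.
  apply: eq_bigr => c _; rewrite SE mxE.
  case: split_ordP => k' /eqP; rewrite ?eq_rshift ?eq_rlshift // => /eqP <-.
  by case: split_ordP => l' /eqP; rewrite ?eq_rshift ?eq_rlshift // => /eqP <-.
have detT : \det T = lead_coef p ^+ e.
  rewrite det_trig => [|]; last first.
    apply/is_trig_mxP => k l kl; rewrite mxE nth_default ?mul0rn // sp.
    by move: kl; lia.
  transitivity (\prod_(i < e) lead_coef p); last by rewrite prodr_const card_ord.
  apply: eq_bigr => k _; rewrite mxE leq_addl addnK mulr1n lead_coefE sp //.
have V0 : \det V != 0 by apply: det_Vandermonde_neq0.
exists (perm h_inj : bool); apply: (mulIf V0).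
rewrite -{1}detM mulrCA -det_mulmx SM det_lblock detT det_mulmx det_diag.
rewrite -!mulrA; congr (_ * (_ * _)); rewrite mulrC; congr (_ * _).
by apply: eq_bigr => i _; rewrite mxE.
Qed.

(** * Integrality of the coefficients of f(X) / (X - x) *)

Lemma Aint_integralP (x : algC) :
  x \in Aint <-> integralOver (intr : int -> algC) x.
Proof.
split=> [|[p mon_p px]]; last first.
  apply: (root_monic_Aint px); first exact: monic_map.
  by apply/polyOverP => i; rewrite coef_map intr_int.
move=> Ax; have {}Ax : minCpoly x \is a polyOver Num.int := Ax.
have /polyOverP Ai := Ax; have [q qP] : exists q : {poly int}, map_poly intr q = minCpoly x.
  exists (map_poly Num.floor (minCpoly x)); rewrite -map_poly_comp_id0 ?floor0 //.
  by apply: map_poly_id => y /(nthP 0)[i _ <-] /=; apply/eqP; rewrite -intrEfloor.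
exists q; last by rewrite qP root_minCpoly.
rewrite monicE; apply/eqP/(@intr_inj algC).
by rewrite -lead_coef_map_inj ?qP ?(monicP (minCpoly_monic x)) //; exact: intr_inj.
Qed.

Lemma root_monic_over_Aint (p : {poly algC}) (x : algC) :
  p \is monic -> p \is a polyOver Aint -> root p x -> x \in Aint.
Proof.
move=> mon_p /polyOverP Ap px; apply/Aint_integralP.
by apply: integral_root_monic px _ => // y /(nthP 0)[i _ <-]; apply/Aint_integralP.
Qed.

(** With a the leading coefficient and d the degree, a^(d-1) p(x) = 0 is a monic equation in a x
    with integral coefficients. *)
Lemma lead_coef_root_Aint (p : {poly algC}) (x : algC) :
  p \is a polyOver Aint -> root p x -> lead_coef p * x \in Aint.
Proof.
move=> /polyOverP Ap px; have [->|p0] := eqVneq p 0; first by rewrite lead_coef0 mul0r.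
have sp : (1 < size p)%N by apply: root_size_gt1 px.
pose d := (size p).-1; pose a := lead_coef p.
have d0 : (0 < d)%N by rewrite /d; lia.
pose g0 := \poly_(i < d) (a ^+ (d.-1 - i) * p`_i); pose g := 'X^d + g0.
have sg : (size g0 < size ('X^d : {poly algC}))%N.
  by rewrite size_polyXn ltnS size_poly.
apply: (@root_monic_over_Aint g).
- by rewrite monicE lead_coefDl // lead_coefXn.
- have Ac i : a ^+ (d.-1 - i) * p`_i \in Aint by apply: rpredM => //; apply: rpredX; exact: Ap.
  apply/polyOverP => i; rewrite coefD coefXn coef_poly.
  by apply: rpredD; [exact: rpred_nat | case: ifP => _; [exact: Ac | exact: rpred0]].
apply/rootP; rewrite hornerD hornerXn horner_poly.
transitivity (a ^+ d.-1 * p.[x]); last by rewrite (rootP px) mulr0.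
rewrite horner_coef (polySpred p0) big_ord_recr /= -/d mulrDr addrC mulr_sumr.
congr (_ + _).
  apply: eq_bigr => i _; rewrite exprMn mulrACA -!mulrA.
  have -> : (d.-1 = d.-1 - i + i)%N by have := ltn_ord i; rewrite /d; lia.
  by rewrite addnK exprD; ring.
by rewrite exprMn -lead_coefE -/a mulrA -exprSr prednK.
Qed.

(** Induction on the degree of h: removing its top term a X^s subtracts a X^(s+1) - (a x) X^s from
    p, and a x is integral although x need not be. *)
Lemma quotient_XsubC_Aint (p h : {poly algC}) (x : algC) :
  p \is a polyOver Aint -> p = h * ('X - x%:P) -> h \is a polyOver Aint.
Proof.
have [n] := ubnP (size h); elim: n => // n IHn in p h *; rewrite ltnS => sh Ap Dp.
have [->|h0] := eqVneq h 0; first by rewrite rpred0.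
pose s := (size h).-1; pose a := lead_coef h.
have aE : lead_coef p = a by rewrite Dp lead_coefM lead_coefXsubC mulr1.
have Aa : a \in Aint by rewrite -aE (polyOverP Ap).
have Aax : a * x \in Aint.
  by rewrite -aE lead_coef_root_Aint // Dp rootM root_XsubC eqxx orbT.
have AXs k : 'X^k \is a polyOver Aint by rewrite rpredX ?polyOverX.
suff Ah : h - a *: 'X^s \is a polyOver Aint.
  by rewrite -(subrK (a *: 'X^s) h) rpredD ?polyOverZ.
apply: (IHn (p - a *: 'X^(s.+1) + (a * x) *: 'X^s)).
- apply: leq_trans sh; rewrite (polySpred h0) ltnS; apply/leq_sizeP => j.
  rewrite coefB coefZ coefXn leq_eqVlt => /orP[/eqP<-|sj].
    by rewrite eqxx mulr1 -[h`_s]lead_coefE subrr.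
  by rewrite gtn_eqF // mulr0 subr0 nth_default // (polySpred h0).
- by rewrite rpredD ?rpredB ?polyOverZ.
rewrite {1}Dp mulrBl -addrA; congr (_ + _).
by rewrite exprSr mulrBr -scalerAl opprB addrC -scalerAl [_ * x%:P]mulrC mul_polyC scalerA.
Qed.

Definition quo (f : {poly int}) (x : algC) : {poly algC} :=
  map_poly intr f %/ ('X - x%:P).

Section Quotient.

Variable f : {poly int}.
Let F : {poly algC} := map_poly intr f.

Lemma quoE x : root F x -> F = quo f x * ('X - x%:P).
Proof. by move=> rx; rewrite /quo divpK // dvdp_XsubCl. Qed.

Lemma intr_poly_Aint : F \is a polyOver Aint.
Proof. by apply/polyOverP => i; rewrite coef_map Aint_int. Qed.

Lemma quo_Aint x k : root F x -> (quo f x)`_k \in Aint.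
Proof. by move/quoE/(quotient_XsubC_Aint intr_poly_Aint)/polyOverP. Qed.

Lemma map_intr_aut (sigma : {rmorphism algC -> algC}) : map_poly sigma F = F.
Proof. by rewrite -map_poly_comp; apply: eq_map_poly => z /=; rewrite rmorph_int. Qed.

Lemma quo_aut (sigma : {rmorphism algC -> algC}) x k :
  sigma (quo f x)`_k = (quo f (sigma x))`_k.
Proof. by rewrite -coef_map /quo map_divp map_intr_aut map_polyXsubC. Qed.

Lemma root_aut (sigma : {rmorphism algC -> algC}) x : root F (sigma x) = root F x.
Proof. by rewrite -{1}(map_intr_aut sigma) fmorph_root. Qed.

Lemma quo_horner x y : root F x -> root F y -> 
  (quo f x).[y] = F^`().[x] * (y == x)%:R.
Proof.
move=> rx ry; have [->|ne] := eqVneq y x.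
  by rewrite {1}(quoE rx) derivM derivXsubC !hornerE subrr mulr0 add0r.
have := rootP ry; rewrite {1}(quoE rx) !hornerE => /eqP.
by rewrite mulf_eq0 subr_eq0 (negPf ne) orbF => /eqP ->.
Qed.

(** Horner's scheme, read from the top coefficient down. *)
Lemma quo_coef x (d k : nat) : root F x -> (size F <= d.+1)%N ->
  (quo f x)`_k = \sum_(l < d) F`_(k + l).+1 * x ^+ l.
Proof.
move=> rx sF; have sq : (size (quo f x) <= d)%N.
  by rewrite size_divp ?polyXsubC_eq0 // size_XsubC leq_subLR add1n.
have [n] := ubnP (d - k); elim: n k => // n IHn k; rewrite ltnS => dk.
have [le_dk|lt_kd] := leqP d k.
  rewrite nth_default ?(leq_trans sq) // big1 // => l _.
  by rewrite nth_default ?mul0r // (leq_trans sF) //; lia.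
have : F`_k.+1 = (quo f x)`_k - (quo f x)`_k.+1 * x.
  by rewrite {1}(quoE rx) mulrBr coefB coefMX coefMC.
move=> e; rewrite -[LHS](subrK ((quo f x)`_k.+1 * x)) -e IHn; last by lia.
case: d lt_kd sF sq dk IHn => // d _ sF sq _ _.
rewrite big_ord_recr big_ord_recl /= addn0 expr0 mulr1; congr (_ + _).
rewrite [F`_(_ + d).+1]nth_default ?mul0r ?addr0 //; last by apply: leq_trans sF _; lia.
by rewrite mulr_suml; apply: eq_bigr => l _; rewrite /bump /= addSnnS exprSr mulrA.
Qed.

End Quotient.

(** * The discriminant as the square of a determinant *)

Lemma resultant_map_intr (p q : {poly int}) :
  resultant (map_poly intr p) (map_poly intr q) = (resultant p q)%:~R :> algC.
Proof.
rewrite /resultant /Sylvester_mx !size_map_inj_poly //; try exact: intr_inj.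
rewrite -det_map_mx /= map_col_mx; congr (\det (col_mx _ _));
  by symmetry; apply: map_lin1_mx => v; rewrite map_poly_rV rmorphM /= map_rVpoly.
Qed.

(* The coefficients of degree < d - 1 of f(X) / (X - x) span together with 1 the
   order of discriminant disc f attached to f, even when f is not monic. *)
Definition quo_mx (f : {poly int}) (d : nat) (x : 'rV[algC]_d) : 'M[algC]_d :=
  \matrix_(i, k) if (k.+1 == d)%N then 1 else (quo f (x 0 i))`_k.

Section Discriminant.

Variables (f : {poly int}) (d : nat) (x : 'rV[algC]_d).
Hypotheses (sf : size f = d.+1) (d1 : (1 < d)%N) (x_inj : injective (x 0)).
Let F : {poly algC} := map_poly intr f.
Hypothesis rx : forall i, root F (x 0 i).
Let a : algC := (lead_coef f)%:~R.
Let V := Vandermonde d x.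
Let B : 'M[algC]_d := \matrix_(i, k) (quo f (x 0 i))`_k.

Let sF : size F = d.+1.
Proof. by rewrite /F size_map_inj_poly //; exact: intr_inj. Qed.

Let lF : F`_d = a.
Proof. by rewrite coef_map /a lead_coefE sf. Qed.

Let f0 : f != 0. Proof. by rewrite -size_poly_gt0 sf. Qed.

Let a0 : a != 0. Proof. by rewrite intr_eq0 lead_coef_eq0. Qed.

(** The top coefficient of f(X) / (X - x) is a for every root x, so the last column of B is a times
    a column of ones. *)
Let detB_quo_mx : \det B = a * \det (quo_mx f x).
Proof.
have dpos : (d.-1 < d)%N by rewrite prednK // ltnW.
have -> : B = quo_mx f x *m diag_mx (\row_k if (k.+1 == d)%N then a else 1).
  apply/matrixP => i k; rewrite mul_mx_diag !mxE; case: eqP => [kd|_]; last by rewrite mulr1.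
  rewrite mul1r (@quo_coef _ _ d) ?sF // (bigD1 (Ordinal (ltnW d1))) //= addn0 kd lF expr0 mulr1.
  rewrite big1 ?addr0 // => l; rewrite -val_eqE /= -lt0n => l0.
  by rewrite nth_default ?mul0r // sF; lia.
rewrite det_mulmx det_diag mulrC (bigD1 (Ordinal dpos)) //= mxE /= prednK ?eqxx; last exact: ltnW.
rewrite big1 ?mulr1 // => k; rewrite -val_eqE /= mxE => ne.
by case: eqP => // kd; case/eqP: ne; lia.
Qed.

Let detBV : \det B * \det V = \prod_i F^`().[x 0 i].
Proof.
rewrite -det_mulmx; have -> : B *m V = diag_mx (\row_i F^`().[x 0 i]).
  apply/matrixP => i j; rewrite !mxE.
  transitivity ((quo f (x 0 i)).[x 0 j]); last first.
    by rewrite quo_horner // (inj_eq x_inj) eq_sym mulr_natr.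
  rewrite (@horner_coef_wide _ d).
    by apply: eq_bigr => k _; rewrite !mxE.
  by rewrite size_divp ?polyXsubC_eq0 // size_XsubC leq_subLR add1n -/F sF.
by rewrite det_diag; apply: eq_bigr => i _; rewrite mxE.
Qed.

(** The coefficients of the quotient are polynomials in x with a triangular system of coefficients
    of f, up to reversal, having a on the diagonal. *)
Let detB_V : exists b : bool, \det B = (-1) ^+ b * a ^+ d * \det V.
Proof.
pose T : 'M[algC]_d := \matrix_(l, k) F`_(k + l).+1.
have BE : B = V^T *m T.
  apply/matrixP => i k; rewrite !mxE (@quo_coef _ _ d) ?sF //.
  by apply: eq_bigr => l _; rewrite !mxE mulrC.
pose s := perm (@rev_ord_inj d).
have detT : (-1) ^+ s * \det T = a ^+ d.
  rewrite -det_row_perm_sign det_trig.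
    transitivity (\prod_(i < d) a); last by rewrite prodr_const card_ord.
    apply: eq_bigr => i _; rewrite !mxE permE /= -lF; congr (_`_ _).
    by have := ltn_ord i; lia.
  apply/is_trig_mxP => i j ij; rewrite !mxE permE /= nth_default // sF.
  by have := ltn_ord j; lia.
by exists (s : bool); rewrite BE det_mulmx det_tr -detT signrMK mulrC.
Qed.

(** Up to sign, (det B)^2 is a^d times the product of the f'(x i), and the resultant is a^(d-1)
    times it; with det B = a det([quo_mx]) this gives a det([quo_mx])^2. The square is rational and
    integral, hence an integer, so the division in [discZ] is exact. *)
Lemma det_quo_mx_sqr : exists b : bool, exists2 z : int,
  resultant f f^`() = (-1) ^+ b * z * lead_coef f & \det (quo_mx f x) ^+ 2 = z%:~R.
Proof.
have Fd : F^`() = map_poly intr f^`() by rewrite deriv_map.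
have sf' : size f^`() = d by rewrite size_deriv sf.
have [b1 B1] := detB_V.
have sF' : size F^`() = d.-1.+1.
  by rewrite Fd size_map_inj_poly ?sf' ?prednK //; [exact: ltnW | exact: intr_inj].
have [b2 res] := resultant_roots sF sF' x_inj rx.
pose R := resultant f f^`().
have RE : resultant F F^`() = R%:~R by rewrite Fd resultant_map_intr.
have key : a * \det (quo_mx f x) ^+ 2 = (-1) ^+ (b1 (+) b2) * R%:~R.
  apply: (mulfI a0); rewrite mulrA -expr2 -exprMn -detB_quo_mx expr2 {2}B1.
  have lFa : lead_coef F = a by rewrite lead_coefE sF lF.
  have ad : a ^+ d = a * a ^+ d.-1 by rewrite -exprS prednK // ltnW.
  rewrite -RE res lFa -detBV ad signr_addb.
  move: ((-1) ^+ b1) ((-1) ^+ b2) (sqrr_sign algC b2) => e1 e2 e22.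
  by rewrite -[LHS]mul1r -e22; ring.
have Aq : \det (quo_mx f x) ^+ 2 \in Aint.
  rewrite rpredX // rpred_sum // => s _; rewrite rpredM ?rpred_sign // rpred_prod // => i _.
  by rewrite mxE; case: ifP => _; [exact: Aint1 | exact: quo_Aint].
have /intrP[z Dz] : \det (quo_mx f x) ^+ 2 \in Num.int.
  rewrite Cint_rat_Aint // -[X in X \in _](mulKf a0) key.
  by rewrite !(rpredM, rpredV, rpred_sign, rpred_int).
exists (b1 (+) b2), z => //.
apply: (@intr_inj algC); rewrite 2!rmorphM rmorph_sign /= -Dz -/a mulrAC -mulrA key.
by rewrite signrMK.
Qed.

Lemma discZ_quo_mx : exists b : bool, \det (quo_mx f x) ^+ 2 = (-1) ^+ b * (discZ f)%:~R.
Proof.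
have [b [z RE ->]] := det_quo_mx_sqr.
exists (odd (d * d.-1)./2 (+) b).
rewrite /discZ RE mulzK ?lead_coef_eq0 // sf /= rmorphM rmorph_sign rmorphM rmorph_sign.
rewrite signr_addb signr_odd.
set e1 := _ ^+ _./2; set e2 := _ ^+ b.
transitivity (e1 ^+ 2 * (e2 ^+ 2 * z%:~R)); first by rewrite !sqrr_sign !mul1r.
by move: e1 e2 => e1 e2; ring.
Qed.

Lemma resultant_discZ : exists b : bool,
  resultant f f^`() = (-1) ^+ b * discZ f * lead_coef f.
Proof.
have [b [z RE _]] := det_quo_mx_sqr.
have dvdR : (lead_coef f %| resultant f f^`())%Z by rewrite RE dvdz_mull.
exists (odd (d * d.-1)./2); rewrite /discZ sf /= signr_odd mulrA -expr2 sqrr_sign mul1r.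
by rewrite divzK.
Qed.

End Discriminant.

(** * Independence of the roots *)

Lemma map_ratr_intr (p : {poly int}) :
  map_poly ratr (map_poly (intr : int -> rat) p) = map_poly intr p :> {poly algC}.
Proof. by rewrite -map_poly_comp; apply: eq_map_poly => z /=; rewrite ratr_int. Qed.

Section IrreducibleRoot.

Variables (f : {poly int}) (x : algC).
Hypotheses (irr_f : irreducible_Zx f) (sf : (1 < size f)%N).
Let F : {poly algC} := map_poly intr f.
Hypothesis fx : root F x.

(** Gauss's lemma: the primitive multiple of the minimal polynomial divides f in Z[X], and
    irreducibility makes the cofactor a unit. *)
Lemma irreducible_minCpoly : exists P : {poly int}, exists r : {poly int},
  [/\ r \is a GRing.unit, f = zprimitive P * r &
      exists2 c : algC, c != 0 & minCpoly x = c *: map_poly intr P].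
Proof.
have [m [Dm mon_m] dv_m] := minCpolyP x.
have [P [a a0 DP]] := rat_poly_scale m.
have a0' : (a%:~R^-1 : rat) != 0 by rewrite invr_eq0 intr_eq0.
have Pf : P %| f.
  rewrite -dvdp_rat_int -(dvdpZl _ _ a0') -DP -dv_m map_ratr_intr //.
have [r Dr] := dvdpP_int Pf.
have sP : (1 < size (zprimitive P))%N.
  rewrite size_zprimitive -size_rat_int_poly -(size_scale _ a0') -DP.
  by rewrite -(size_map_poly (ratr : {rmorphism rat -> algC})) -Dm size_minCpoly.
exists P, r; split=> //.
  have [_ [_ /(_ _ _ Dr)[]//]] := irr_f.
  by rewrite poly_unitE => /andP[/eqP s1 _]; rewrite s1 in sP.
exists (ratr a%:~R^-1); first by rewrite fmorph_eq0.
by rewrite Dm DP linearZ /= map_ratr_intr.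
Qed.

Lemma irreducible_dvd (q : {poly int}) :
  root (map_poly intr q) x -> exists r, q = f * r.
Proof.
have [P [r [ur Df [c c0 Dm]]]] := irreducible_minCpoly => qx.
have [m [Dm' _] dv_m] := minCpolyP x.
have /dvdpP_int[s ->] : P %| q.
  rewrite -dvdp_rat_int -(dvdp_map (ratr : {rmorphism rat -> algC})) /= !map_ratr_intr.
  by rewrite -(dvdpZl _ _ c0) -Dm Dm' -map_ratr_intr dvdp_map -dv_m map_ratr_intr.
by exists (r^-1 * s); rewrite Df mulrA mulrK.
Qed.

Lemma irreducible_conjugate (y : algC) : root F y -> root (minCpoly x) y.
Proof.
have [P [r [ur Df [c c0 Dm]]]] := irreducible_minCpoly.
rewrite /F Df rmorphM rootM => /orP[|]; last first.
  move: ur; rewrite poly_unitE => /andP[/size_poly1P[e e0 ->] _].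
  by rewrite /= map_polyC /= rootC intr_eq0 (negPf e0).
rewrite Dm rootZ // {2}(zpolyEprim P) map_polyZ /= !rootE hornerZ => /eqP->.
by rewrite mulr0.
Qed.

Lemma irreducible_simple_root : F^`().[x] != 0.
Proof.
apply/negP => f'x; have [|r Dr] := irreducible_dvd (q := f^`()).
  by rewrite -deriv_map rootE.
have f'0 : f^`() != 0.
  by rewrite -size_poly_gt0 size_deriv -subn1 subn_gt0.
have r0 : r != 0 by apply: contra_neq f'0 => r0; rewrite Dr r0 mulr0.
have f0 : f != 0 by rewrite -size_poly_gt0 ltnW.
have := lt_size_deriv f0; rewrite Dr size_mul // -subn1.
by rewrite ltnNge -addnBA ?size_poly_gt0 // leq_addr.
Qed.

(** If g is monic with root eta x, then g(eta X) vanishes at x, is a multiple of f in Z[X], and has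
    a power of eta as leading coefficient. *)
Lemma lead_coef_dvd_expn (eta : nat) : (0 < eta)%N -> eta%:R * x \in Aint ->
  exists k : nat, (lead_coef f %| (eta : int) ^+ k)%Z.
Proof.
move=> eta0 /Aint_integralP[g mon_g gx].
pose q := \poly_(i < size g) (g`_i * (eta : int) ^+ i).
have g0 : (0 < size g)%N by rewrite size_poly_gt0 monic_neq0.
have lg : g`_(size g).-1 = 1 by rewrite -lead_coefE (monicP mon_g).
have sq : size q = size g.
  by apply: size_poly_eq; rewrite lg mul1r expf_neq0 //; case: eta eta0 {gx q}.
have [|r Dq] := irreducible_dvd (q := q).
  rewrite rootE horner_coef size_map_inj_poly //; last exact: intr_inj.
  rewrite sq; move/rootP: gx; rewrite horner_coef size_map_inj_poly //; last exact: intr_inj.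
  move=> gx0; apply/eqP; rewrite -[RHS]gx0; apply: eq_bigr => i _.
  by rewrite !coef_map /= coef_poly ltn_ord rmorphM rmorphXn /= exprMn mulrA.
exists (size g).-1.
have <- : lead_coef q = (eta : int) ^+ (size g).-1.
  by rewrite lead_coefE sq coef_poly prednK // leqnn lg mul1r.
by rewrite Dq lead_coefM dvdz_mulr.
Qed.

End IrreducibleRoot.

Lemma irreducible_roots (f : {poly int}) : irreducible_Zx f -> (1 < size f)%N ->
  exists d : nat, exists x : 'rV[algC]_d, [/\ size f = d.+1, injective (x 0),
    forall i, root (map_poly intr f) (x 0 i) &
    forall y, root (map_poly intr f) y -> exists i, y = x 0 i].
Proof.
move=> irr_f sf; pose F : {poly algC} := map_poly intr f.
have [s Ds] := closed_field_poly_normal F.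
have f0 : f != 0 by rewrite -size_poly_gt0 ltnW.
have lF : lead_coef F != 0.
  by rewrite lead_coef_map_inj ?intr_eq0 ?lead_coef_eq0 //; exact: intr_inj.
have rs y : root F y = (y \in s) by rewrite Ds rootZ // root_prod_XsubC.
have us : uniq s.
  rewrite -separable_prod_XsubC -(eqp_separable (eqp_scale _ lF)) -Ds.
  rewrite unlock; apply/Pdiv.ClosedField.root_coprimep => y Fy.
  exact: (irreducible_simple_root irr_f sf).
exists (size s), (\row_i s`_i); split.
- have <- : size F = size f by rewrite size_map_inj_poly //; exact: intr_inj.
  by rewrite Ds size_scale // size_prod_XsubC.
- by move=> i j; rewrite !mxE => /eqP; rewrite nth_uniq // => /eqP/val_inj.
- by move=> i; rewrite mxE rs mem_nth.
move=> y; rewrite rs => /(nthP 0)[i lti <-].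
by exists (Ordinal lti); rewrite mxE.
Qed.

(** * Separating families attached to roots of polynomials *)

Lemma subring_det (S : algC -> Prop) (n : nat) (A : 'M[algC]_n) :
  subring_of_algC S -> (forall i j, S (A i j)) -> S (\det A).
Proof.
move=> sS SA; apply: (subring_sum sS) => s _ _; apply: (subringM sS).
  by apply: (subringX sS); apply: (subringN sS); exact: subring1.
by apply: (subring_prod sS).
Qed.

Section RootSeparation.

Variables (m : nat) (rho : 'I_m -> algC).
Hypothesis rho_inj : injective rho.
Hypothesis rho_closed : forall (sigma : {rmorphism algC -> algC}) i,
  exists j, sigma (rho i) = rho j.

Notation G := (autG rho).
Notation K := (inL rho).

Definition fixs (l : seq algC) : {set 'S_m} :=
  [set g in G | all (fun y => gaut rho g y == y) l].

Lemma fixsE l g : (g \in fixs l) = (g \in G) && all (fun y => gaut rho g y == y) l.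
Proof. by rewrite [g \in fixs l]in_set. Qed.

Lemma fixsP l g : reflect (g \in G /\ {in l, forall y, gaut rho g y = y}) (g \in fixs l).
Proof.
rewrite fixsE; apply: (iffP andP) => -[gG fixl]; split=> //.
  by move=> y /(allP fixl)/eqP.
by apply/allP => y /fixl ->.
Qed.

Lemma fixs_sub l : fixs l \subset G.
Proof. by apply/subsetP => g /fixsP[]. Qed.

Lemma fixs_group_set l : {in l, forall y, K y} -> group_set (fixs l).
Proof.
move=> Kl; apply/group_setP; split.
  by apply/fixsP; split=> // y yl; rewrite gaut1 //; exact: Kl.
move=> g h /fixsP[gG gl] /fixsP[hG hl]; apply/fixsP; split; first exact: groupM.
by move=> y yl; rewrite gautM ?gl ?hl //; exact: Kl.
Qed.

Lemma fixs_cons y l : fixs (y :: l) = fixs [:: y] :&: fixs l.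
Proof. by apply/setP => g; rewrite in_setI !fixsE /= andbT; case: (g \in G). Qed.

Lemma sep_fixs (S : algC -> Prop) (I : eqType) (y c : I -> algC) (l : seq I) :
    S 1 -> (forall x z, S x -> S z -> S (x * z)) ->
  (forall i, i \in l -> sep rho S (fixs [:: y i]) (c i)) ->
  sep rho S (fixs (map y l)) (\prod_(i <- l) c i).
Proof.
move=> S1 SM; elim: l => [|i l IHl] sep_l.
  exists [:: (1, 1)]; last by move=> p; rewrite inE => /eqP->.
  have K1 : K 1 := subring1 (inL_subring rho).
  split=> [p|g gG].
    by rewrite inE => /eqP->; split=> //= h _; rewrite rmorph1.
  by rewrite big_seq1 big_nil fixsE gG /= rmorph1 !mul1r.
rewrite map_cons fixs_cons big_cons; apply: sep_mul => //.
  by apply: sep_l; rewrite mem_head.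
by apply: IHl => j jl; apply: sep_l; rewrite inE jl orbT.
Qed.

Section OnePolynomial.

Variables (f : {poly int}).
Let F : {poly algC} := map_poly intr f.
Hypothesis KF : forall y, root F y -> K y.

Lemma quo_inK y k : root F y -> K (quo f y)`_k.
Proof.
move=> Fy; rewrite (@quo_coef _ _ (size f)) //; last first.
  by rewrite size_map_inj_poly //; exact: intr_inj.
apply: (subring_sum (inL_subring rho)) => l _ _.
apply: (subringM (inL_subring rho)).
  by rewrite coef_map; exact: (subring_int (inL_subring rho)).
by apply: (subringX (inL_subring rho)); exact: KF.
Qed.

Lemma mem_fixs1 g y : g \in G -> (g \in fixs [:: y]) = (gaut rho g y == y).
Proof. by move=> gG; rewrite fixsE gG /= andbT. Qed.

Lemma sep_powers (S : algC -> Prop) y : root F y -> (forall k, S (y ^+ k)) ->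
  sep rho S (fixs [:: y]) F^`().[y].
Proof.
move=> Fy Sy; exists [seq (y ^+ k, (quo f y)`_k) | k <- iota 0 (size f)]; last first.
  by move=> _ /mapP[k _ ->]; exact: Sy.
split=> [_ /mapP[k _ ->]|g gG] /=.
  split; [|exact: quo_inK|exact: quo_Aint|].
    by apply: (subringX (inL_subring rho)); exact: KF.
  by move=> h /fixsP[_ fixy]; rewrite quo_aut fixy ?mem_head.
rewrite big_map -[size f]subn0 big_mkord mem_fixs1 //.
transitivity ((quo f (gaut rho g y)).[y]).
  rewrite (@horner_coef_wide _ (size f)).
    by apply: eq_bigr => k _; rewrite quo_aut mulrC.
  rewrite size_divp ?polyXsubC_eq0 // size_XsubC.
  by rewrite size_map_inj_poly ?leq_subr //; exact: intr_inj.
rewrite quo_horner ?root_aut // eq_sym.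
by case: eqP => [->|]; rewrite ?mulr0.
Qed.

Hypotheses (irr_f : irreducible_Zx f) (sf : (3 <= size f)%N).

(** Cramer's rule: W times its adjugate is det W, and multiplying by det W once more leaves the
    discriminant up to sign. Automorphisms permute the rows of W. Unlike in [sep_powers], the
    constant is an integer and the left factors are integral. *)
Lemma sep_disc y : root F y -> sep rho (fun x => x \in Aint) (fixs [:: y]) (discZ f)%:~R.
Proof.
move=> Fy; have [d [x [sfd x_inj rx xr]]] := irreducible_roots irr_f (ltnW sf).
have d1 : (1 < d)%N by have := sf; rewrite sfd.
have [b detW] := discZ_quo_mx sfd d1 x_inj rx.
have [i0 Dy] := xr y Fy; pose W := quo_mx f x.
have KW i k : K (W i k).
  rewrite mxE; case: ifP => _; [exact: subring1 (inL_subring rho) | exact: quo_inK].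
have AW i k : W i k \in Aint.
  by rewrite mxE; case: ifP => _; [exact: Aint1 | exact: quo_Aint].
have gW (sigma : {rmorphism algC -> algC}) i i' k :
    sigma (x 0 i) = x 0 i' -> sigma (W i k) = W i' k.
  by move=> e; rewrite !mxE; case: ifP => _; rewrite ?rmorph1 ?quo_aut ?e.
have Adet n (A : 'M_n) : (forall i j, A i j \in Aint) -> \det A \in Aint.
  move=> AA; apply: rpred_sum => s _.
  by rewrite rpredM ?rpred_sign // rpred_prod.
have Kadj i k : K (\adj W i k).
  rewrite mxE; apply: (subringM (inL_subring rho)).
    apply: (subringX (inL_subring rho)); apply: (subringN (inL_subring rho)).
    exact: subring1 (inL_subring rho).
  by apply: subring_det (inL_subring rho) _ => i' j'; rewrite 2!mxE; exact: KW.
have Aadj i k : \adj W i k \in Aint.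
  by rewrite mxE rpredM ?rpred_sign // Adet // => i' j'; rewrite 2!mxE; exact: AW.
pose a k := (-1) ^+ b * \det W * \adj W k i0.
exists [seq (a k, W i0 k) | k <- enum 'I_d]; last first.
  move=> _ /mapP[k _ ->] /=; rewrite /a !rpredM ?rpred_sign //.
  exact: Adet.
split=> [_ /mapP[k _ ->]|g gG] /=.
  split=> //.
    apply: (subringM (inL_subring rho)) => //.
    apply: (subringM (inL_subring rho)); last exact: subring_det (inL_subring rho) _.
    apply: (subringX (inL_subring rho)); apply: (subringN (inL_subring rho)).
    exact: subring1 (inL_subring rho).
  by move=> h /fixsP[_ fixy]; apply: gW; rewrite -Dy fixy ?mem_head.
have [i Di] := xr (gaut rho g y) (etrans (root_aut _ _ _) Fy).
rewrite big_map big_enum /= mem_fixs1 // Di Dy (inj_eq x_inj).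
transitivity ((-1) ^+ b * \det W * (W *m \adj W) i i0).
  rewrite mxE mulr_sumr; apply: eq_bigr => k _.
  by rewrite (gW _ _ i) -?Dy // /a -!mulrA; congr (_ * (_ * _)); rewrite mulrC.
have -> : (W *m \adj W) i i0 = \det W * (i == i0)%:R.
  by rewrite mul_mx_adj mxE mulr_natr.
transitivity ((-1) ^+ b * \det W ^+ 2 * (i == i0)%:R); first by ring.
by rewrite detW signrMK.
Qed.

Lemma sep_roots_disc (l : seq algC) : (forall y, y \in l -> root F y) ->
  sep rho (fun x => x \in Aint) (fixs l) ((discZ f)%:~R ^+ size l).
Proof.
move=> lF; have -> : (discZ f)%:~R ^+ size l = \prod_(y <- l) (discZ f)%:~R :> algC.
  by rewrite big_const_seq count_predT iter_mulr_1.
rewrite -{1}[l]map_id; apply: sep_fixs; [exact: Aint1 | exact: rpredM | by move=> y /lF /sep_disc].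
Qed.

End OnePolynomial.

(* H1 <*> H2 has an everywhere unramified fixed field, hence is all of G. *)
Lemma coprime_sep_prod (H1 H2 : {group 'S_m}) (D1 D2 : int) :
    coprimez D1 D2 -> H1 \subset G -> H2 \subset G -> (G \subset 'N(H1))%g ->
    sep rho (fun x => x \in Aint) H1 D1%:~R -> sep rho (fun x => x \in Aint) H2 D2%:~R ->
  (G \subset H1 * H2)%g.
Proof.
move=> coD sH1 sH2 nH1 sep1 sep2.
have sH : (H1 <*> H2 \subset G)%g by rewrite join_subG sH1.
have [[u v] /= bez] := coprimezP _ _ coD.
have intP (z : int) : (z%:~R : algC) \in Aint /\ K z%:~R.
  by rewrite Aint_int; split=> //; exact: (subring_int (inL_subring rho)).
have sepH : sep rho (fun x => x \in Aint) (H1 <*> H2)%G 1.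
  have -> : 1 = u%:~R * D1%:~R + v%:~R * D2%:~R :> algC.
    by rewrite -!rmorphM -rmorphD bez.
  have [? ?] := intP u; have [? ?] := intP v.
  apply: sep_lin => //; first exact: rpredM.
    by apply: sep_trace sep1 => //; exact: joing_subl.
  by apply: sep_trace sep2 => //; exact: joing_subr.
have := unramified_full rho_inj rho_closed sH sepH.
by rewrite /= norm_joinEr // (subset_trans sH2).
Qed.

End RootSeparation.

Lemma root_family_exists (r : nat) (f : 'I_r -> {poly int}) :
    (forall i, f i != 0) ->
  exists m : nat, exists rho : 'I_m -> algC, [/\ injective rho,
    forall (sigma : {rmorphism algC -> algC}) i, exists j, sigma (rho i) = rho j
    & forall i y, root (map_poly intr (f i)) y -> exists j, y = rho j].
Proof.
move=> f0; pose F i : {poly algC} := map_poly intr (f i).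
pose rts i := sval (closed_field_poly_normal (F i)).
have rtsP i y : root (F i) y = (y \in rts i).
  rewrite /rts; case: closed_field_poly_normal => s /= {1}->; rewrite rootZ ?root_prod_XsubC //.
  by rewrite lead_coef_map_inj ?intr_eq0 ?lead_coef_eq0 //; exact: intr_inj.
pose s := undup (flatten [seq rts i | i <- enum 'I_r]).
have sP y : reflect (exists i, root (F i) y) (y \in s).
  rewrite mem_undup; apply: (iffP flatten_mapP) => [[i _ ys]|[i Fy]].
    by exists i; rewrite rtsP.
  by exists i; rewrite ?mem_enum -?rtsP.
exists (size s), (fun j => s`_j); split.
- by move=> i j /eqP; rewrite nth_uniq ?undup_uniq // => /eqP/val_inj.
- move=> sigma i; have : sigma s`_i \in s.
    have /sP[k Fk] : s`_i \in s by rewrite mem_nth.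
    by apply/sP; exists k; rewrite root_aut.
  by case/(nthP 0) => j ltj e; exists (Ordinal ltj).
move=> i y Fy; have /(nthP 0)[j ltj e] : y \in s by apply/sP; exists i.
by exists (Ordinal ltj).
Qed.

Lemma coprimez_prodr (I : eqType) (l : seq I) (a : int) (D : I -> int) :
  (forall i, i \in l -> coprimez a (D i)) -> coprimez a (\prod_(i <- l) D i).
Proof.
elim: l => [|i l IHl] co; first by rewrite big_nil coprimezE coprimen1.
rewrite big_cons coprimezMr co ?mem_head //=.
by apply: IHl => j jl; apply: co; rewrite inE jl orbT.
Qed.

Section Independence.

Variables (r : nat) (f : 'I_r -> {poly int}) (alpha : 'I_r -> algC).
Hypothesis irr_f : forall i, irreducible_Zx (f i).
Hypothesis sf : forall i, (3 <= size (f i))%N.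
Hypothesis coD : forall i j, i != j -> coprimez (discZ (f i)) (discZ (f j)).
Hypothesis f_alpha : forall i, root (map_poly intr (f i)) (alpha i).

(* Adjoin the alpha i one at a time: the field of the previous ones and the
   splitting field of the next polynomial have coprime discriminants. *)
Lemma independent_conjugates (beta : 'I_r -> algC) :
    (forall i, root (map_poly intr (f i)) (beta i)) ->
  exists sigma : {rmorphism algC -> algC}, forall i, sigma (alpha i) = beta i.
Proof.
move=> f_beta.
have f0 i : f i != 0 by rewrite -size_poly_gt0 (leq_trans _ (sf i)).
have [m [rho [rho_inj rho_closed rhoF]]] := root_family_exists f0.
have KF i y : root (map_poly intr (f i)) y -> inL rho y.
  by move=> /rhoF[j ->]; exact: inL_gen.
suff H l : uniq l -> exists2 g, g \in autG rho & {in l, forall i, gaut rho g (alpha i) = beta i}.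
  have [g _ gP] := H (enum 'I_r) (enum_uniq _).
  by exists (gaut rho g) => i; rewrite gP ?mem_enum.
elim: l => [_|k l IHl /= /andP[kl ul]]; first by exists 1%g.
have [g0 g0G g0P] := IHl ul.
have [d [x [sfd x_inj rx xr]]] := irreducible_roots (irr_f k) (ltnW (sf k)).
(* H1 fixes all roots of the new polynomial, a normal extension, whereas H2 fixes only the chosen
   roots of the previous ones; the product H1 H2 will be the whole group. *)
pose l1 := codom (x 0); pose l2 := map alpha l.
have K1 : {in l1, forall y, inL rho y} by move=> _ /codomP[i ->]; exact: KF (rx i).
have K2 : {in l2, forall y, inL rho y} by move=> _ /mapP[i _ ->]; exact: KF (f_alpha i).
pose H1 := group (fixs_group_set K1); pose H2 := group (fixs_group_set K2).
have sep1 : sep rho (fun z => z \in Aint) H1 (discZ (f k) ^+ size l1)%:~R.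
  rewrite rmorphXn; apply: sep_roots_disc => //; first exact: KF.
  by move=> _ /codomP[i ->].
have sep2 : sep rho (fun z => z \in Aint) H2 (\prod_(i <- l) discZ (f i))%:~R.
  rewrite rmorph_prod; apply: sep_fixs; [exact: Aint1 | exact: rpredM |] => i il.
  by apply: sep_disc => //; exact: KF.
have sH1 : H1 \subset autG rho by exact: fixs_sub.
have sH2 : H2 \subset autG rho by exact: fixs_sub.
have co : coprimez (discZ (f k) ^+ size l1) (\prod_(i <- l) discZ (f i)).
  rewrite coprimezXl // coprimez_prodr // => i il; apply: coD.
  by apply: contraNneq kl => ->.
have fix1 h y : h \in H1 -> root (map_poly intr (f k)) y -> gaut rho h y = y.
  by move=> /fixsP[_ fixl] /xr[i ->]; apply: fixl; exact: codom_f.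
have nH1 : (autG rho \subset 'N(H1))%g.
  apply/normsP => g gG; apply/eqP; rewrite eqEcard cardJg leqnn andbT.
  apply/subsetP => _ /imsetP[h hH1 ->]; have hG := subsetP sH1 h hH1.
  apply/fixsP; split; first by rewrite groupJ.
  move=> y yl1; have [i Dy] := codomP yl1; have Ky := K1 y yl1.
  have giG : (g^-1)%g \in autG rho by rewrite groupV.
  have hgG : (h * g)%g \in autG rho by rewrite groupM.
  rewrite conjgE gautM // gautM //; last exact: inK_aut.
  rewrite (fix1 h) //; last by rewrite root_aut Dy.
  by rewrite -gautM // mulVg gaut1.
have GH := coprime_sep_prod rho_inj rho_closed co sH1 sH2 nH1 sep1 sep2.
have [tau Dtau] := minCpoly_conjugate
  (irreducible_conjugate (irr_f k) (f_alpha k) (f_beta k)).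
have [t tG tP] := gaut_exists rho_inj rho_closed tau.
have /mulsgP[h1 h2 h1H h2H e] : (t * g0^-1)%g \in (H1 * H2)%g.
  by rewrite (subsetP GH) // groupM ?groupV.
have h1G := subsetP sH1 h1 h1H; have h2G := subsetP sH2 h2 h2H.
(* Both expressions of u are used: as h2 g0 it agrees with g0 on the previous roots, which h2 fixes,
   and as h1^-1 t it agrees with t on alpha k, which h1 fixes. *)
have [u Du Eu] : exists2 u, u = (h2 * g0)%g & u = (h1^-1 * t)%g.
  by exists (h2 * g0)%g; rewrite // -(mulgKV g0 t) e !mulgA mulVg mul1g.
have h1iH : (h1^-1)%g \in H1 by rewrite groupV.
have h1iG := subsetP sH1 _ h1iH.
exists u; first by rewrite Du; exact: groupM h2G g0G.
move=> i; rewrite inE => /predU1P[->|il]; last first.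
  rewrite Du gautM //; last exact: KF (f_alpha i).
  have /fixsP[_ ->] := h2H; [exact: g0P | exact: map_f].
rewrite Eu gautM //; last exact: KF (f_alpha k).
by rewrite (fix1 _ _ h1iH) // tP ?Dtau //; exact: KF (f_alpha k).
Qed.

End Independence.

(** * Ideals of R *)

Definition ring_gen (r : nat) (alpha : 'I_r -> algC) (x : algC) : Prop :=
  forall S, subring_of_algC S -> (forall i, S (alpha i)) -> S x.

Lemma ring_gen_subring (r : nat) (alpha : 'I_r -> algC) : subring_of_algC (ring_gen alpha).
Proof.
split; first by move=> S [].
split; first by move=> x y Lx Ly S sS Sa; apply: subringB (Lx S sS Sa) (Ly S sS Sa).
by move=> x y Lx Ly S sS Sa; apply: subringM (Lx S sS Sa) (Ly S sS Sa).
Qed.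

Lemma ring_gen_mem (r : nat) (alpha : 'I_r -> algC) i : ring_gen alpha (alpha i).
Proof. by move=> S _; apply. Qed.

Section Order.

Variables (r : nat) (f : 'I_r -> {poly int}) (alpha : 'I_r -> algC).
Hypothesis irr_f : forall i, irreducible_Zx (f i).
Hypothesis sf : forall i, (3 <= size (f i))%N.
Hypothesis f_alpha : forall i, root (map_poly intr (f i)) (alpha i).

Let F i : {poly algC} := map_poly intr (f i).

Lemma deriv_mul_inO x : inO alpha x ->
  ring_gen alpha ((\prod_(i <- enum 'I_r) (F i)^`().[alpha i]) * x).
Proof.
case=> Lx Ax.
have f0 i : f i != 0 by rewrite -size_poly_gt0 (leq_trans _ (sf i)).
have [m [rho [rho_inj rho_closed rhoF]]] := root_family_exists f0.
have KF i y : root (F i) y -> inL rho y by move=> /rhoF[j ->]; exact: inL_gen.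
have sR := ring_gen_subring alpha.
have [s fam Ss] : sep rho (ring_gen alpha) (fixs rho (map alpha (enum 'I_r)))
    (\prod_(i <- enum 'I_r) (F i)^`().[alpha i]).
  apply: sep_fixs; [exact: subring1 sR | exact: subringM sR |] => i _.
  apply: sep_powers => //; first exact: KF.
  by move=> k; apply: (subringX sR); exact: ring_gen_mem.
have Kl : {in map alpha (enum 'I_r), forall y, inL rho y}.
  by move=> _ /mapP[i _ ->]; exact: KF (f_alpha i).
pose H := group (fixs_group_set Kl).
have sHG : H \subset autG rho by exact: fixs_sub.
have Kx : inL rho x.
  by move=> S sS Srho; apply: (Lx S sS) => i; exact: (KF i _ (f_alpha i) S sS Srho).
have fixx : fixed_by rho H x.
  move=> h /fixsP[_ fixl]; apply: (@eq_aut_inL _ alpha _ idfun) => // i.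
  by apply: fixl; rewrite map_f ?mem_enum.
rewrite (separating_expand sHG fam Kx fixx); apply: (subring_sum sR) => p ps _.
apply: (subringM sR); first exact: Ss.
have [_ K2 A2 fix2] := fam.1 p ps.
have /intrP[z ->] : coset_trace rho H (autG rho) (p.2 * x) \in Num.int.
  apply: coset_trace_int => //.
  - exact: (subringM (inL_subring rho)).
  - by rewrite rpredM.
  by move=> h hH; rewrite rmorphM /= fix2 ?fixx.
exact: (subring_int sR).
Qed.

(** At alpha i the relation Res = u f + v f' becomes Res = v(alpha i) f'(alpha i), which trades the
    derivatives for integers. *)
Lemma resultant_mul_inO x : inO alpha x ->
  ring_gen alpha ((\prod_(i <- enum 'I_r) resultant (f i) (f i)^`())%:~R * x).
Proof.
move=> /deriv_mul_inO Dx; have sR := ring_gen_subring alpha.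
have R i : exists2 w, ring_gen alpha w &
    (resultant (f i) (f i)^`())%:~R = w * (F i)^`().[alpha i].
  have sf' : (1 < size (f i)^`())%N by rewrite size_deriv -subn1 ltn_subRL.
  have [[u v] /= _ e] := resultant_in_ideal (ltnW (sf i)) sf'.
  exists (map_poly intr v).[alpha i].
    by apply: (subring_horner sR); exact: ring_gen_mem.
  have := congr1 (fun p : {poly int} => (map_poly (intr : int -> algC) p).[alpha i]) e.
  rewrite map_polyC hornerC /= => ->.
  by rewrite rmorphD !rmorphM /= hornerD !hornerM (rootP (f_alpha i)) mulr0 add0r /F deriv_map.
have [w Sw Rw] := fin_all_exists2 R.
rewrite rmorph_prod; have -> : \prod_(i <- enum 'I_r) (resultant (f i) (f i)^`())%:~R
  = \prod_(i <- enum 'I_r) w i * \prod_(i <- enum 'I_r) (F i)^`().[alpha i].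
  by rewrite -big_split; apply: eq_bigr => i _; exact: Rw.
rewrite -mulrA; apply: (subringM sR) => //; apply: (subring_prod sR) => i _ _.
exact: Sw.
Qed.

End Order.

(** Both sides have degree less than d and agree at the d roots of f. *)
Lemma sum_quo_horner (f : {poly int}) (d : nat) (x : 'rV[algC]_d) (y : algC) :
    size f = d.+1 -> injective (x 0) -> (forall i, root (map_poly intr f) (x 0 i)) ->
  \sum_i (quo f (x 0 i)).[y] = (map_poly intr f)^`().[y].
Proof.
move=> sf x_inj rx; pose F : {poly algC} := map_poly intr f.
have sF : size F = d.+1 by rewrite size_map_inj_poly //; exact: intr_inj.
pose g := \sum_i quo f (x 0 i) - F^`().
suff g0 : g = 0.
  by apply/eqP; rewrite -subr_eq0 -horner_sum -hornerN -hornerD -/g g0 horner0.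
apply/eqP; apply: contraTT isT => g_neq0.
pose rs := codom (x 0); have : (size rs < size g)%N.
  apply: (max_poly_roots g_neq0); last by rewrite map_inj_uniq ?enum_uniq.
  apply/allP => _ /codomP[i ->]; rewrite rootE hornerD hornerN horner_sum.
  rewrite (bigD1 i) //= big1 => [|j ne]; last first.
    by rewrite quo_horner // (inj_eq x_inj) eq_sym (negPf ne) mulr0.
  by rewrite quo_horner // eqxx mulr1 addr0 subrr.
rewrite /rs size_codom card_ord ltnNge => /negP[]; apply: leq_trans (size_polyD _ _) _.
rewrite size_polyN geq_max; apply/andP; split; last first.
  by rewrite -ltnS -sF lt_size_deriv // -size_poly_gt0 sF.
apply: (leq_trans (size_sum _ _ _)); apply/bigmax_leqP => i _.
by rewrite size_divp ?polyXsubC_eq0 // size_XsubC -/F sF subn1.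
Qed.

Section Ideals.

Variables (r : nat) (alpha : 'I_r -> algC) (eta : nat).
Hypothesis eta0 : (0 < eta)%N.

Notation O := (inO alpha).
Notation R := (inR alpha eta).

Let etaC : eta%:R != 0 :> algC. Proof. by rewrite pnatr_eq0 -lt0n. Qed.

Lemma inO_subring : subring_of_algC O.
Proof.
have sL := inL_subring alpha.
split; first by split; [exact: subring1 sL | exact: Aint1].
split=> x y [Lx Ax] [Ly Ay]; split.
- exact: subringB sL _ _ Lx Ly.
- by rewrite rpredB.
- exact: subringM sL _ _ Lx Ly.
by rewrite rpredM.
Qed.

Lemma inR_subring : subring_of_algC R.
Proof.
have sO := inO_subring; have eO k : O (eta%:R ^+ k).
  by apply: (subringX sO); exact: (subring_nat sO).
split; first by exists 0%N; rewrite mulr1.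
split=> x y [k Ox] [l Oy]; exists (k + l)%N; rewrite exprD.
  rewrite mulrBr {1}[eta%:R ^+ k * _]mulrC -!mulrA.
  by apply: (subringB sO); apply: (subringM sO).
by rewrite mulrACA; apply: (subringM sO).
Qed.

Lemma inR_div_eta x k : R x -> R (x / eta%:R ^+ k).
Proof.
case=> l Ox; exists (l + k)%N.
by rewrite exprD mulrACA mulrA mulfK ?expf_neq0 // in Ox *.
Qed.

Lemma inR_eta_inv k : R (eta%:R ^+ k)^-1.
Proof. by rewrite -[_^-1]mul1r; apply: inR_div_eta; exact: subring1 inR_subring. Qed.

Lemma inR_eta_Aint x : R x -> exists k : nat, eta%:R ^+ k * x \in Aint.
Proof. by case=> k [_ Ax]; exists k. Qed.

Section OneIdeal.

Variable a : algC -> Prop.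
Hypothesis ida : is_idealR alpha eta a.

Lemma ideal_inR x : a x -> R x. Proof. by case: ida => + _; apply. Qed.
Lemma ideal0 : a 0. Proof. by case: ida => _ []. Qed.
Lemma idealD x y : a x -> a y -> a (x + y). Proof. by case: ida => _ [_ [+ _]]; apply. Qed.
Lemma idealM c x : R c -> a x -> a (c * x). Proof. by case: ida => _ [_ [_]]; apply. Qed.
Lemma idealMr c x : a x -> R c -> a (x * c).
Proof. by move=> ax Rc; rewrite mulrC; apply: idealM. Qed.
Lemma idealN x : a x -> a (- x).
Proof.
move=> ax; rewrite -mulN1r; apply: idealM => //.
by apply: (subringN inR_subring); exact: subring1 inR_subring.
Qed.
Lemma idealB x y : a x -> a y -> a (x - y).
Proof. by move=> ax ay; apply: idealD => //; exact: idealN. Qed.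
Lemma idealBC x y : a (x - y) -> a (y - x).
Proof. by move/idealN; rewrite opprB. Qed.
Lemma ideal_trans y x z : a (x - y) -> a (y - z) -> a (x - z).
Proof. by move=> axy ayz; rewrite -(subrKA y); apply: idealD. Qed.
Lemma ideal_sum (I : eqType) (l : seq I) (G : I -> algC) :
  (forall i, i \in l -> a (G i)) -> a (\sum_(i <- l) G i).
Proof.
move=> aG; rewrite big_seq; elim/big_ind: _ => //; [exact: ideal0 | exact: idealD].
Qed.

Lemma ideal_horner (p : {poly int}) x y : R x -> R y -> a (x - y) ->
  a ((map_poly intr p).[x] - (map_poly intr p).[y]).
Proof.
move=> Rx Ry axy; elim/poly_ind: p => [|p c IHp].
  by rewrite map_poly0 !horner0 subrr; exact: ideal0.
rewrite rmorphD rmorphM /= map_polyX map_polyC !hornerE.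
set u := _.[x] in IHp *; set v := _.[y] in IHp *.
have -> : u * x + c%:~R - (v * y + c%:~R) = u * (x - y) + (u - v) * y by ring.
apply: idealD; last exact: idealMr.
by apply: idealM => //; exact: (subring_horner inR_subring).
Qed.

(* z / eta^k is congruent to an integer, eta being a unit modulo d. *)
Lemma degree_one_int_rep (d : nat) b : degree_one alpha eta a -> coprime d eta ->
  a d%:R -> R b -> exists z : int, a (b - z%:~R).
Proof.
move=> deg1 co ad /deg1[_ [[w [k ->]] abw]].
have cok : coprimez ((eta : int) ^+ k) d by rewrite coprimezXl // coprimez_sym.
have [[u t] /= bez] := coprimezP _ _ cok.
exists (w * u); apply: ideal_trans abw _.
have -> : w%:~R / eta%:R ^+ k - (w * u)%:~R = w%:~R * t%:~R * (eta%:R ^+ k)^-1 * d%:R :> algC.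
  have e : u%:~R * eta%:R ^+ k + t%:~R * d%:R = 1 :> algC.
    have := congr1 (intr : int -> algC) bez.
    by rewrite rmorphD !rmorphM rmorphXn.
  have ek : eta%:R ^+ k != 0 :> algC by rewrite expf_neq0.
  rewrite rmorphM /= -[w%:~R / _]mulr1 -{1}e; field.
  exact: ek.
apply: idealM => //; do !apply: (subringM inR_subring); try exact: (subring_int inR_subring).
exact: inR_eta_inv.
Qed.

End OneIdeal.

Lemma gen_ideal_idealR (xs : seq algC) : (forall x, x \in xs -> R x) ->
  is_idealR alpha eta (gen_ideal alpha eta xs).
Proof.
move=> Rxs; have sR := inR_subring; split.
  move=> _ [cs [_ [Rcs ->]]]; apply: (subring_sum sR) => i _ _.
  by apply: (subringM sR); [exact: Rcs | apply/Rxs/mem_nth].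
split.
  exists (nseq (size xs) 0); rewrite size_nseq; split=> //; split=> [i lti|].
    by rewrite nth_nseq lti; exact: subring0 sR.
  by rewrite big1 // => i _; rewrite nth_nseq ltn_ord mul0r.
split=> [_ _ [cs [_ [Rcs ->]]] [ds [_ [Rds ->]]]|c _ Rc [cs [_ [Rcs ->]]]].
  exists (mkseq (fun i => cs`_i + ds`_i) (size xs)); rewrite size_mkseq; split=> //; split.
    by move=> i lti; rewrite nth_mkseq //; apply: (subringD sR); auto.
  by rewrite -big_split; apply: eq_bigr => i _; rewrite nth_mkseq // mulrDl.
exists (mkseq (fun i => c * cs`_i) (size xs)); rewrite size_mkseq; split=> //; split.
  by move=> i lti; rewrite nth_mkseq //; apply: (subringM sR); auto.
by rewrite mulr_sumr; apply: eq_bigr => i _; rewrite nth_mkseq // mulrA.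
Qed.

Lemma gen_ideal_mem (xs : seq algC) x : x \in xs -> gen_ideal alpha eta xs x.
Proof.
case/(nthP 0) => j ltj <-; have sR := inR_subring.
exists (mkseq (fun i => (i == j)%:R) (size xs)); rewrite size_mkseq; split=> //; split.
  by move=> i lti; rewrite nth_mkseq //; exact: (subring_nat sR).
rewrite (bigD1 (Ordinal ltj)) //= nth_mkseq // eqxx mul1r big1 ?addr0 // => i.
by rewrite -val_eqE /= nth_mkseq // => /negPf ->; rewrite mul0r.
Qed.

Lemma gen_ideal_min (a : algC -> Prop) (xs : seq algC) y : is_idealR alpha eta a ->
  (forall x, x \in xs -> a x) -> gen_ideal alpha eta xs y -> a y.
Proof.
move=> ida axs [cs [_ [Rcs ->]]]; apply: (ideal_sum ida) => i _.
by apply: (idealM ida); [exact: Rcs | apply/axs/mem_nth].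
Qed.

End Ideals.

(** * Integer representatives modulo an ideal *)

Section DegreeOneIdeals.

Variables (r : nat) (f : 'I_r -> {poly int}) (alpha : 'I_r -> algC) (eta n : nat).
Hypothesis irr_f : forall i, irreducible_Zx (f i).
Hypothesis sf : forall i, (3 <= size (f i))%N.
Hypothesis coD : forall i j, i != j -> coprimez (discZ (f i)) (discZ (f j)).
Hypothesis f_alpha : forall i, root (map_poly intr (f i)) (alpha i).
Hypothesis eta0 : (0 < eta)%N.
Hypothesis eta_alpha : forall i, inO alpha (eta%:R * alpha i).
Hypothesis co_n_eta : coprime n eta.
Hypothesis co_n_disc : forall i, coprimez n (discZ (f i)).

Notation R := (inR alpha eta).
Let sR : subring_of_algC R := inR_subring alpha eta.

Let R_alpha i : R (alpha i).
Proof. by exists 1%N; rewrite expr1. Qed.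

Let R_int (z : int) : R z%:~R. Proof. exact: (subring_int sR). Qed.
Let R_nat (k : nat) : R k%:R. Proof. exact: (subring_nat sR). Qed.

(** Up to sign the resultant is the discriminant times the leading coefficient, and the latter
    divides a power of eta. *)
Lemma coprime_resultant i : coprimez n (resultant (f i) (f i)^`()).
Proof.
have [d [x [sfd x_inj rx _]]] := irreducible_roots (irr_f i) (ltnW (sf i)).
have d1 : (1 < d)%N by have := sf i; rewrite sfd.
have [b ->] := resultant_discZ sfd d1 x_inj rx.
have [|k lc_dvd] := lead_coef_dvd_expn (irr_f i) (f_alpha i) eta0; first by case: (eta_alpha i).
rewrite coprimezMr [coprimez _ ((-1) ^+ b * _)]coprimezMr co_n_disc andbT; apply/andP; split.
  by case: b => //=; rewrite coprimezE /= coprimen1.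
have : coprimez n ((eta : int) ^+ k) by rewrite coprimezXr.
by rewrite !coprimezE; apply: coprime_dvdr; rewrite -dvdzE.
Qed.

Section OneTuple.

Variables (v : 'I_r -> nat) (a : algC -> Prop).
Hypothesis ida : is_idealR alpha eta a.
Hypothesis a_alpha : forall i, a (alpha i - (v i)%:R).
Hypothesis an : a n%:R.

(** The elements of R congruent to integers form a ring containing the alpha i, hence a multiple c
    eta^k x with c a product of resultants; c eta^k is invertible modulo n. *)
Lemma ideal_int_rep x : R x -> exists z : int, a (x - z%:~R).
Proof.
case=> k Ox; pose c := \prod_(i <- enum 'I_r) resultant (f i) (f i)^`().
have /(_ (fun y => R y /\ exists z : int, a (y - z%:~R)))[] :=
    resultant_mul_inO sf f_alpha Ox.
- split; first by split; [exact: subring1 sR | exists 1; rewrite subrr; exact: ideal0 ida].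
  split=> x1 x2 [R1 [z1 a1]] [R2 [z2 a2]]; split.
  + exact: (subringB sR).
  + exists (z1 - z2); rewrite rmorphB /=.
    have -> : x1 - x2 - (z1%:~R - z2%:~R) = (x1 - z1%:~R) - (x2 - z2%:~R) by ring.
    exact: (idealB ida).
  + exact: (subringM sR).
  exists (z1 * z2); rewrite rmorphM /=.
  have -> : x1 * x2 - z1%:~R * z2%:~R = x1 * (x2 - z2%:~R) + z2%:~R * (x1 - z1%:~R) by ring.
  by apply: (idealD ida); apply: (idealM ida).
- by move=> i; split=> //; exists (v i); apply: a_alpha.
move=> _ [z az].
have co : coprimez (c * (eta : int) ^+ k) n.
  rewrite coprimezMl [X in _ && X]coprimezXl ?andbT; last by rewrite coprimez_sym.
  by rewrite coprimez_sym coprimez_prodr // => i _; exact: coprime_resultant.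
have [[u w] /= bez] := coprimezP _ _ co.
have Rx : R x by exists k.
exists (u * z).
have -> : x - (u * z)%:~R = u%:~R * (c%:~R * (eta%:R ^+ k * x) - z%:~R) + w%:~R * x * n%:R.
  have e : u%:~R * (c%:~R * eta%:R ^+ k) + w%:~R * n%:R = 1 :> algC.
    have := congr1 (intr : int -> algC) bez.
    by rewrite rmorphD !rmorphM rmorphXn.
  transitivity ((u%:~R * (c%:~R * eta%:R ^+ k) + w%:~R * n%:R) * x - u%:~R * z%:~R).
    by rewrite e mul1r rmorphM.
  by ring.
apply: (idealD ida); apply: (idealM ida) => //.
by apply: (subringM sR).
Qed.

End OneTuple.

Lemma psi_mapP v : let a := psi_map alpha eta n v in
  [/\ is_idealR alpha eta a, forall i, a (alpha i - (v i)%:R) & a n%:R].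
Proof.
move=> a; split.
- apply: gen_ideal_idealR => x; rewrite mem_cat inE => /orP[/mapP[i _ ->]|/eqP->] //.
  exact: (subringB sR).
- by move=> i; apply: gen_ideal_mem; rewrite mem_cat (map_f (fun i => alpha i - _)) ?mem_enum.
by apply: gen_ideal_mem; rewrite mem_cat mem_head orbT.
Qed.

Lemma psi_map_min v (b : algC -> Prop) x : is_idealR alpha eta b ->
  (forall i, b (alpha i - (v i)%:R)) -> b n%:R -> psi_map alpha eta n v x -> b x.
Proof.
move=> idb ba bn; apply: gen_ideal_min => // y.
by rewrite mem_cat inE => /orP[/mapP[i _ ->]|/eqP->].
Qed.

(** The norm is given by arbitrary representatives. Among 0, ..., n two integers are congruent, so a
    contains a least positive integer d; then 0, ..., d - 1 also represent R modulo a, and comparing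
    the two systems gives d = n. *)
Lemma in_S_int (a : algC -> Prop) : in_S alpha eta n a ->
  (forall z : int, a z%:~R <-> (n %| z)%Z) /\
  (forall x, R x -> exists2 k : nat, (k < n)%N & a (x - k%:R)).
Proof.
case=> ida _ _ deg1 [s [_ [Rs [s_ne s_cov]]]].
have cov x : R x -> exists i : 'I_n, a (x - s`_i).
  by move=> /s_cov[i lti ax]; exists (Ordinal lti).
have [h hP] := fin_all_exists (fun i : 'I_n.+1 => cov i%:R (R_nat i)).
have /injectivePn[i [j ne eqh]] : ~~ injectiveb h.
  by apply/injectiveP => /leq_card; rewrite !card_ord ltnn.
have asym x y z : a (x - z) -> a (y - z) -> a (x - y).
  by move=> ax ay; apply: (ideal_trans ida ax); exact: (idealBC ida).
have [d0 d0_gt0 ad0] : exists2 d : nat, (0 < d)%N & a d%:R.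
  wlog ij : i j ne eqh / (i < j)%N.
    move=> W; have [|/(W j i)|e] := ltngtP i j; first exact: W.
      by apply=> //; rewrite eq_sym.
    by case/eqP: ne; exact: val_inj.
  exists (j - i)%N; first by rewrite subn_gt0.
  rewrite natrB 1?ltnW //; apply: (asym _ _ s`_(h j)) => //.
  by rewrite -eqh.
have exd : exists d : nat,
    (0 < d)%N && (if excluded_middle_informative (a d%:R) then true else false).
  by exists d0; rewrite d0_gt0; case: excluded_middle_informative.
case: (ex_minnP exd) => d /andP[d_gt0]; case: excluded_middle_informative => // ad _ d_min.
have {}d_min k : (0 < k)%N -> a k%:R -> (d <= k)%N.
  by move=> k0 ak; apply: d_min; rewrite k0; case: excluded_middle_informative.
(* As eta is invertible in R, a also contains d/g for g = gcd(d, eta), and minimality of d forces g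
   = 1. *)
have co_d : coprime d eta.
  pose g := gcdn d eta; have g0 : (0 < g)%N by rewrite gcdn_gt0 d_gt0.
  have Ed : d = (d %/ g * g)%N by rewrite divnK // dvdn_gcdl.
  have Ee : eta = (eta %/ g * g)%N by rewrite divnK // dvdn_gcdr.
  have adg : a (d %/ g)%:R.
    have -> : (d %/ g)%:R = (eta %/ g)%:R * (eta%:R ^+ 1)^-1 * d%:R :> algC.
      have gC : g%:R != 0 :> algC by rewrite pnatr_eq0 -lt0n.
      have eg : (eta %/ g)%:R != 0 :> algC.
        by rewrite pnatr_eq0 -lt0n divn_gt0 // dvdn_leq // dvdn_gcdr.
      by rewrite expr1 [in X in X^-1]Ee [in RHS]Ed !natrM; field; rewrite gC eg.
    by apply: (idealM ida) => //; apply: (subringM sR) => //; exact: inR_eta_inv.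
  have dg0 : (0 < d %/ g)%N by rewrite divn_gt0 // dvdn_leq // dvdn_gcdl.
  have := d_min _ dg0 adg; rewrite {1}Ed -[X in (_ <= X)%N]muln1 leq_pmul2l // => g1.
  by rewrite /coprime eqn_leq g1.
have az (z : int) : a z%:~R <-> (d %| z)%Z.
  split=> [azz|/dvdzP[q ->]]; last first.
    by rewrite rmorphM; apply: (idealM ida); [exact: R_int | exact: ad].
  have am : a (`|(z %% d)%Z|%N)%:R.
    rewrite natr_absz ger0_norm ?modz_ge0 ?eqz_nat -?lt0n // /modz rmorphB rmorphM /=.
    by apply: (idealB ida) => //; apply: (idealM ida); [exact: R_int | exact: ad].
  apply/dvdz_mod0P/eqP; apply: contraT => nz.
  have := d_min _ _ am; rewrite absz_gt0 nz => /(_ isT).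
  by rewrite leqNgt -ltz_nat gez0_abs ?modz_ge0 ?ltz_pmod ?eqz_nat -?lt0n.
have cov_d x : R x -> exists k : 'I_d, a (x - (k : nat)%:R).
  move=> Rx; have [z azx] := degree_one_int_rep eta0 ida deg1 co_d ad Rx.
  have ltz : (`|(z %% d)%Z| < d)%N.
    by rewrite -ltz_nat gez0_abs ?modz_ge0 ?ltz_pmod ?eqz_nat -?lt0n.
  exists (Ordinal ltz) => /=; apply: (ideal_trans ida azx).
  rewrite natr_absz ger0_norm ?modz_ge0 ?eqz_nat -?lt0n // -rmorphB /=.
  by apply/az; rewrite /modz opprB addrC subrK dvdz_mull.
have nd : n = d.
  apply/eqP; rewrite eqn_leq; apply/andP; split.
    have [g gP] := fin_all_exists (fun i : 'I_n => cov_d s`_i (Rs i (ltn_ord i))).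
    rewrite -[n]card_ord -[d]card_ord; apply: (leq_card g) => i1 i2 eqg.
    apply/eqP/contraT => /eqP ne12; case: (s_ne i1 i2) => //; first by move/val_inj.
    by apply: asym (gP i1) _; rewrite eqg.
  have [g gP] := fin_all_exists (fun k : 'I_d => cov (k : nat)%:R (R_nat k)).
  rewrite -[n]card_ord -[d]card_ord; apply: (leq_card g) => k1 k2 eqg.
  have : a ((k1 : nat)%:R - (k2 : nat)%:R) by apply: asym (gP k1) _; rewrite eqg.
  have -> : (k1 : nat)%:R - (k2 : nat)%:R = ((k1 : nat)%:Z - (k2 : nat)%:Z)%:~R :> algC.
    by rewrite rmorphB.
  move/az; rewrite -eqz_mod_dvd => /eqP; rewrite !modz_small ?lez_nat ?ltz_nat ?ltn_ord //.
  by move=> [e]; exact: val_inj.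
rewrite nd; split=> // x /cov_d[k ak]; by exists k.
Qed.

Lemma root_of_ideal a v i : is_idealR alpha eta a -> a (alpha i - (v i)%:R) ->
  (forall z : int, a z%:~R -> (n %| z)%Z) -> (n %| (f i).[(v i : int)])%Z.
Proof.
move=> ida av an; apply: an.
have := ideal_horner ida (f i) (R_alpha i) (R_nat (v i)) av.
rewrite (rootP (f_alpha i)) sub0r => /(idealN ida); rewrite opprK.
by rewrite -[(v i)%:R]/((v i : int)%:~R) horner_map.
Qed.

End DegreeOneIdeals.

(** * The ideal attached to a tuple of roots modulo n *)

Section RootTuple.

Variables (r : nat) (f : 'I_r -> {poly int}) (alpha : 'I_r -> algC) (eta n : nat).
Hypothesis irr_f : forall i, irreducible_Zx (f i).
Hypothesis sf : forall i, (3 <= size (f i))%N.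
Hypothesis coD : forall i j, i != j -> coprimez (discZ (f i)) (discZ (f j)).
Hypothesis f_alpha : forall i, root (map_poly intr (f i)) (alpha i).
Hypothesis eta0 : (0 < eta)%N.
Hypothesis eta_alpha : forall i, inO alpha (eta%:R * alpha i).
Hypothesis n2 : (2 <= n)%N.
Hypothesis co_n_eta : coprime n eta.
Hypothesis co_n_disc : forall i, coprimez n (discZ (f i)).
Variable v : 'I_r -> nat.

Notation R := (inR alpha eta).
Let F i : {poly algC} := map_poly intr (f i).
Let V (i : 'I_r) : algC := (v i)%:R.

Let FV i : (F i).[V i] = (f i).[(v i : int)]%:~R.
Proof. by rewrite -horner_map. Qed.

Lemma quo_horner_Aint i y (k : nat) : root (F i) y -> (quo (f i) y).[k%:R] \in Aint.
Proof.
move=> Fy; rewrite horner_coef; apply: rpred_sum => j _.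
by rewrite rpredM ?quo_Aint // rpredX // Aint_Cnat ?natr_nat.
Qed.

(* f_i(X) / (X - alpha i) at v i multiplies alpha i - v i into n Z, as does n. *)
Lemma psi_map_annihilated x : (forall i, (n %| (f i).[(v i : int)])%Z) ->
    psi_map alpha eta n v x ->
  exists k : nat, exists2 y, y \in Aint &
    eta%:R ^+ k * (\prod_i (quo (f i) (alpha i)).[V i]) * x = n%:R * y.
Proof.
move=> nf; have sR := inR_subring alpha eta.
pose s := \prod_i (quo (f i) (alpha i)).[V i].
have As : s \in Aint by apply: rpred_prod => i _; exact: quo_horner_Aint _ (f_alpha _).
have An k : k%:R \in Aint by rewrite Aint_Cnat ?natr_nat.
(* J is an ideal of R, the powers of eta clearing the denominators of the multipliers; it is
   therefore enough to test the generators. *)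
pose J x := R x /\ exists k : nat, exists2 y, y \in Aint & eta%:R ^+ k * s * x = n%:R * y.
suff: psi_map alpha eta n v x -> J x by move=> JP /JP[].
apply: psi_map_min.
- split; first by move=> y [].
  split; first by split; [exact: subring0 sR | exists 0%N, 0; rewrite ?Aint0 ?mulr0].
  split=> [x1 x2 [R1 [k1 [y1 A1 e1]]] [R2 [k2 [y2 A2 e2]]]|c x1 Rc [R1 [k1 [y1 A1 e1]]]].
    split; first exact: (subringD sR).
    exists (k1 + k2)%N, (eta%:R ^+ k2 * y1 + eta%:R ^+ k1 * y2).
      by rewrite rpredD // rpredM // rpredX.
    transitivity (eta%:R ^+ k2 * (eta%:R ^+ k1 * s * x1) + eta%:R ^+ k1 * (eta%:R ^+ k2 * s * x2)).
      by rewrite exprD; ring.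
    by rewrite e1 e2; ring.
  split; first exact: (subringM sR).
  have [k Ac] := inR_eta_Aint Rc.
  exists (k + k1)%N, (eta%:R ^+ k * c * y1); first by rewrite rpredM.
  transitivity (eta%:R ^+ k * c * (eta%:R ^+ k1 * s * x1)); first by rewrite exprD; ring.
  by rewrite e1; ring.
- move=> i; split.
    apply: (subringB sR); first by exists 1%N; rewrite expr1.
    exact: (subring_nat sR).
  have /dvdzP[z Dz] := nf i.
  exists 0%N, (- z%:~R * \prod_(j | j != i) (quo (f j) (alpha j)).[V j]).
    rewrite rpredM ?rpredN ?Aint_int // rpred_prod // => j _; exact: quo_horner_Aint _ (f_alpha _).
  have e : (quo (f i) (alpha i)).[V i] * (V i - alpha i) = z%:~R * n%:R.
    have := FV i; rewrite /F {1}(quoE (f_alpha i)) hornerM hornerXsubC Dz => ->.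
    by rewrite rmorphM.
  rewrite expr0 mul1r /s (bigD1 i) //=.
  move: e; set q := _.[_]; set p := \prod_(j | _) _; rewrite -/(V i) => e.
  transitivity (- (q * (V i - alpha i)) * p); first by ring.
  by rewrite e; ring.
split; first exact: (subring_nat sR).
by exists 0%N, s; rewrite // expr0 mul1r mulrC.
Qed.

(* Automorphisms carry (alpha i) to every tuple of roots y i; the sum of the
   conjugate equations involves sum_y f_i(X) / (X - y) = f_i'(X). *)
Lemma dvd_prod_deriv (p k : nat) :
    (exists2 y, y \in Aint &
       eta%:R ^+ k * (\prod_i (quo (f i) (alpha i)).[V i]) = p%:R * y) ->
  (0 < p)%N -> (p %| (eta : int) ^+ k * \prod_i (f i)^`().[(v i : int)])%Z.
Proof.
case=> y Ay ey p0.
have f0 i : f i != 0 by rewrite -size_poly_gt0 (leq_trans _ (sf i)).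
have [m [rho [rho_inj _ rhoF]]] := root_family_exists f0.
pose Q i j := root (F i) (rho j).
pose H i j := (quo (f i) (rho j)).[V i].
have sumH i : \sum_(j | Q i j) H i j = (F i)^`().[V i].
  have [d [x [sfd x_inj rx xr]]] := irreducible_roots (irr_f i) (ltnW (sf i)).
  rewrite -(sum_quo_horner _ sfd x_inj rx).
  have -> : \sum_(j | Q i j) H i j = \sum_(z <- map rho (enum (Q i))) (quo (f i) z).[V i].
    by rewrite big_map big_enum.
  have -> : \sum_j (quo (f i) (x 0 j)).[V i] = \sum_(z <- codom (x 0)) (quo (f i) z).[V i].
    by rewrite big_map big_enum.
  apply: perm_big; apply: uniq_perm.
  - by rewrite map_inj_uniq ?enum_uniq.
  - by rewrite map_inj_uniq ?enum_uniq.
  move=> z; apply/mapP/codomP => [[j]|[j Dz]].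
    by rewrite mem_enum => Qj ->; have [i' ->] := xr _ Qj; exists i'.
  have Fz : root (F i) z by rewrite Dz; exact: rx.
  have [j' Dj'] := rhoF i z Fz; exists j' => //.
  by rewrite mem_enum; change (root (F i) (rho j') : Prop); rewrite -Dj'.
have key : exists2 y, y \in Aint &
    eta%:R ^+ k * \prod_i (F i)^`().[V i] = p%:R * y.
  (* The condition on phi sits inside the conclusion so that a witness can be chosen for every phi;
     it is 0 when phi is not a tuple of roots. *)
  have conj_dvd (phi : {ffun 'I_r -> 'I_m}) : exists2 y, y \in Aint &
      phi \in family Q -> eta%:R ^+ k * \prod_i H i (phi i) = p%:R * y.
    have [/familyP Qphi|nQ] := boolP (phi \in family Q); last by exists 0; rewrite ?rpred0.
    have [sigma Ds] := independent_conjugates irr_f sf coD f_alpha (beta := rho \o phi) Qphi.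
    exists (sigma y); first by rewrite Aint_aut.
    move=> _; have := congr1 sigma ey; rewrite !rmorphM rmorphXn !rmorph_nat rmorph_prod /= => <-.
    congr (_ * _); apply: eq_bigr => i _.
    rewrite /H -[rho (phi i)]Ds -horner_map /= rmorph_nat; congr (_.[_]).
    by apply/polyP => l; rewrite coef_map /= quo_aut.
  have [z Az zP] := fin_all_exists2 conj_dvd.
  exists (\sum_(phi in family Q) z phi); first by apply: rpred_sum => phi _.
  (* Distributing the product over these sums gives one term for each tuple of roots, and every term
     is a conjugate of the given product. *)
  under eq_bigr do rewrite -sumH.
  rewrite bigA_distr_big_dep !mulr_sumr; apply: eq_bigr => phi Qphi; exact: zP.
have [{}y {}Ay {}ey] := key.
have yE : y = ((eta : int) ^+ k * \prod_i (f i)^`().[(v i : int)])%:~R / p%:R.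
  have pC : p%:R != 0 :> algC by rewrite pnatr_eq0 -lt0n.
  apply: (mulfI pC); rewrite -ey mulrCA mulfV // mulr1 rmorphM rmorphXn rmorph_prod /=.
  by congr (_ * _); apply: eq_bigr => i _; rewrite /F deriv_map -horner_map.
have /intrP[z Dz] : y \in Num.int.
  by rewrite Cint_rat_Aint // yE rpred_div ?rpred_int ?rpred_nat.
apply/dvdzP; exists z; apply: (@intr_inj algC); rewrite [RHS]rmorphM /= -Dz yE.
by rewrite -[p%:~R]/(p%:R) divfK // pnatr_eq0 -lt0n.
Qed.

(** The multiplier s sends both d and n into n times the algebraic integers, hence also g = gcd(n,
    d). If n does not divide d, then n/g has a prime factor p, and s itself is p times an algebraic
    integer. *)
Lemma psi_map_int (d : int) : (forall i, (n %| (f i).[(v i : int)])%Z) ->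
  psi_map alpha eta n v d%:~R -> (n %| d)%Z.
Proof.
move=> nf /(psi_map_annihilated nf)[k [y Ay ey]].
apply: contraT => nd; pose g := gcdn n `|d|.
have n0 : (0 < n)%N by exact: ltnW.
have g0 : (0 < g)%N by rewrite gcdn_gt0 n0.
have Dn : n = (n %/ g * g)%N by rewrite divnK // dvdn_gcdl.
have ng1 : (1 < n %/ g)%N.
  have ng0 : (0 < n %/ g)%N by rewrite divn_gt0 // dvdn_leq // dvdn_gcdl.
  rewrite ltn_neqAle ng0 andbT; apply: contra nd => /eqP e1.
  by rewrite dvdzE /= Dn -e1 mul1n dvdn_gcdr.
pose p := pdiv (n %/ g); have pr_p : prime p := pdiv_prime ng1.
have [q Dq] : exists q, (n %/ g = q * p)%N by apply/dvdnP; exact: pdiv_dvd.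
have pn : (p %| n)%N by rewrite Dn Dq mulnAC dvdn_mull.
have [[u w] /= bez] : exists uw : int * int, uw.1 * d + uw.2 * n = g.
  by have [u [w e]] := Bezoutz d n; exists (u, w); rewrite /= e /gcdz gcdnC.
set s := eta%:R ^+ k * _ in ey.
have As : s \in Aint.
  apply: rpredM; first by apply: rpredX; rewrite Aint_Cnat ?natr_nat.
  by apply: rpred_prod => i _; exact: quo_horner_Aint _ (f_alpha _).
have es : s = p%:R * (q%:R * (u%:~R * y + w%:~R * s)).
  have gC : g%:R != 0 :> algC by rewrite pnatr_eq0 -lt0n.
  apply: (mulIf gC); have e : u%:~R * d%:~R + w%:~R * n%:R = g%:R :> algC.
    by have := congr1 (intr : int -> algC) bez; rewrite rmorphD !rmorphM.
  have nC : n%:R = q%:R * p%:R * g%:R :> algC by rewrite -!natrM -Dq -Dn.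
  transitivity (u%:~R * (s * d%:~R) + w%:~R * n%:R * s); first by rewrite -e; ring.
  by rewrite ey nC; ring.
have : (p %| (eta : int) ^+ k * \prod_i (f i)^`().[(v i : int)])%Z.
  apply: dvd_prod_deriv; last exact: prime_gt0.
  exists (q%:R * (u%:~R * y + w%:~R * s)) => //.
  apply: rpredM; first by rewrite Aint_Cnat ?natr_nat.
  by apply: rpredD; apply: rpredM => //; exact: Aint_int.
(* A prime p dividing both f i and its derivative at v i would divide their resultant, which is
   prime to n. *)
have co : coprimez p ((eta : int) ^+ k * \prod_i (f i)^`().[(v i : int)]).
  rewrite coprimezMr coprimezXr /=; last by rewrite coprimezE (coprime_dvdl pn).
  rewrite -big_enum; apply: coprimez_prodr => i _.
  rewrite coprimezE prime_coprime //; apply/negP => pf'.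
  have pf : (p %| (f i).[(v i : int)])%Z by apply: dvdz_trans (nf i); rewrite dvdzE.
  have sf' : (1 < size (f i)^`())%N by rewrite size_deriv -subn1 ltn_subRL.
  have [[a b] /= _ e] := resultant_in_ideal (ltnW (sf i)) sf'.
  have := congr1 (fun h : {poly int} => h.[(v i : int)]) e.
  rewrite hornerC hornerD !hornerM => eR.
  have pR : (p %| resultant (f i) (f i)^`())%Z.
    by rewrite eR rpredD // dvdz_mull // dvdzE.
  have := coprime_resultant irr_f sf f_alpha eta0 eta_alpha co_n_eta co_n_disc i.
  rewrite coprimezE => /(coprime_dvdl pn); rewrite prime_coprime //.
  by rewrite -[X in (X %| _)%N]/(`|p%:Z|%N) -dvdzE pR.
move: co; rewrite coprimezE prime_coprime // => /negP nco; rewrite dvdzE => /nco.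
by [].
Qed.

End RootTuple.

Theorem theorem4p3 (r : nat) (f : 'I_r -> {poly int}) (alpha : 'I_r -> algC)
  (eta : nat) :
  (forall i, primitive_Zx (f i)) ->
  (forall i, irreducible_Zx (f i)) ->
  (forall i, (3 <= size (f i))%N) ->
  (forall i j, i != j -> coprimez (discZ (f i)) (discZ (f j))) ->
  (forall i, root (map_poly intr (f i)) (alpha i)) ->
  (0 < eta)%N ->
  (forall i, inO alpha (eta%:R * alpha i)) ->
  forall n : nat, (2 <= n)%N ->
    coprime n (eta * `|(\prod_(i < r) discZ (f i))%R|%N) ->
    (forall a, in_S alpha eta n a ->
       root_tuple f n (phi_map alpha n a) /\
       (forall x, psi_map alpha eta n (phi_map alpha n a) x <-> a x)) /\
    (forall v, root_tuple f n v ->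
       in_S alpha eta n (psi_map alpha eta n v) /\
       (forall i, phi_map alpha n (psi_map alpha eta n v) i = v i)).
Proof.
move=> _ irr_f sf coD f_alpha eta0 eta_alpha n n2.
rewrite coprimeMr => /andP[co_n_eta co_n_D].
have co_n_disc i : coprimez n (discZ (f i)).
  rewrite coprimezE; apply: coprime_dvdr co_n_D.
  by rewrite -dvdzE (bigD1 i) //= dvdz_mulr.
have sR := inR_subring alpha eta.
have R_alpha i : inR alpha eta (alpha i) by exists 1%N; rewrite expr1.
have n0 : (0 < n)%N := ltnW n2.
have nz : n%:Z != 0 by rewrite eqz_nat -lt0n.
have int_rep := ideal_int_rep irr_f sf f_alpha eta0 eta_alpha co_n_eta co_n_disc.
split=> [a Sa|v root_v].
  have [an acov] := in_S_int eta0 Sa; have [ida _ _ _ _] := Sa.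
  pose v := phi_map alpha n a.
  have vP i : (v i < n)%N /\ a (alpha i - (v i)%:R).
    apply: (epsilon_spec (inhabits 0%N) (fun k => (k < n)%N /\ a (alpha i - k%:R))).
    by have [k ltk ak] := acov _ (R_alpha i); exists k.
  have ann : a n%:R by apply/(an n).
  split=> [i|x].
    by split; [case: (vP i) | apply: (root_of_ideal f_alpha eta_alpha ida (vP i).2) => z /an].
  split=> [|ax]; first by apply: psi_map_min => // i; case: (vP i).
  (* For the inclusion of a in the generated ideal: x is congruent to an integer z modulo the
     latter, z then lies in a, so n divides z and z lies in the generated ideal. *)
  have [idp pa pn] := psi_mapP n eta_alpha v.
  have [z az] := int_rep v _ idp pa pn x (ideal_inR ida ax).
  have /an nz' : a z%:~R.
    have : a (x - z%:~R) by apply: psi_map_min az => // i; case: (vP i).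
    by move=> /(idealB ida ax); rewrite subKr.
  rewrite -[x](subrK z%:~R); apply: (idealD idp) => //.
  by case/dvdzP: nz' => q ->; rewrite rmorphM; apply: (idealM idp) => //; exact: (subring_int sR).
pose a := psi_map alpha eta n v; have [ida aa an] := psi_mapP n eta_alpha v.
have a_int (d : int) : a d%:~R -> (n %| d)%Z.
  apply: psi_map_int => // i; by case: (root_v i).
have a_nat (k l : nat) : (k < n)%N -> (l < n)%N -> a (k%:R - l%:R) -> k = l.
  move=> kn ln; have -> : k%:R - l%:R = (k%:Z - l%:Z)%:~R :> algC by rewrite rmorphB.
  move/a_int; rewrite -eqz_mod_dvd => /eqP; rewrite !modz_small ?lez_nat ?ltz_nat //.
  by move=> [].
split.
  split=> //.
  - exists 1; split; first exact: subring1 sR.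
    by move=> /(a_int 1); rewrite dvdzE dvdn1 => /eqP n1; move: n2; rewrite (n1 : n = 1%N).
  - by exists n%:R; split=> //; apply/eqP; rewrite pnatr_eq0 -lt0n.
  - move=> b /(int_rep v _ ida aa an)[z az]; exists z%:~R; split=> //.
    by exists z, 0%N; rewrite expr0 divr1.
  exists (mkseq (fun i => i%:R) n); split; first by rewrite size_mkseq.
  split; first by move=> i lti; rewrite nth_mkseq //; exact: (subring_nat sR).
  split=> [i j lti ltj ne|b /(int_rep v _ ida aa an)[z az]].
    by rewrite !nth_mkseq // => /(a_nat _ _ lti ltj).
  have ltz : (`|(z %% n)%Z| < n)%N.
    by rewrite -ltz_nat gez0_abs ?modz_ge0 ?ltz_pmod.
  exists `|(z %% n)%Z|%N => //; rewrite nth_mkseq //; apply: (ideal_trans ida az).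
  rewrite natr_absz ger0_norm ?modz_ge0 // -rmorphB /= /modz opprB addrC subrK rmorphM.
  by apply: (idealM ida) => //; exact: (subring_int sR).
move=> i; have [lt_vi _] := root_v i.
have [lt_k ak] : (phi_map alpha n a i < n)%N /\ a (alpha i - (phi_map alpha n a i)%:R).
  apply: (epsilon_spec (inhabits 0%N) (fun k => (k < n)%N /\ a (alpha i - k%:R))).
  by exists (v i); split=> //; exact: aa.
by apply: a_nat => //; apply: (ideal_trans ida _ (aa i)); exact: (idealBC ida).
Qed.
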